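(* For every $n\ge 1$ let $Q_n$ be a uniformly random rooted quadrangulation with $n$ faces. For every $\varepsilon,\delta>0$, $$\mathbb{P}\left(\tau_{Q_n}(\varepsilon)\le n^{3/2+\delta}\right)\longrightarrow 1\qquad\text{as } n\to\infty,$$ where $\tau_{Q_n}(\varepsilon)$ is the $\varepsilon$-uniform mixing time of the lazy random walk on the vertices of $Q_n$.
   Context: A rooted planar map is an embedding of a (connected) planar graph on the sphere without edge-crossings, up to orientation-preserving homeomorphisms, with a distinguished oriented edge (the root edge). A quadrangulation is a rooted planar map all of whose faces have degree 4 (multiple edges are allowed: type I). $V(Q),E(Q),F(Q)$ denote the sets of vertices, edges and faces of $Q$, and $|Q|=|F(Q)|$. $\deg_Q(x)$ is the degree of $x$, and $\operatorname{mult}_Q(x,y)$ the number of edges with endpoints $x$ and $y$. The lazy random walk on $Q$ is the Markov chain on $V(Q)$ with transition probabilities $p_Q(x,x)=1/2$ and $p_Q(x,y)=\frac{\operatorname{mult}_Q(x,y)}{2\deg_Q(x)}$ for $x\ne y$. Its stationary distribution is $\pi_Q(x)=\frac{\deg_Q(x)}{4|Q|}$. With $p_Q^k$ the $k$-step transition probabilities, $$\tau_Q(\varepsilon)=\inf\left\{k:\ \forall x,y\in V(Q),\ \left|\frac{p_Q^k(x,y)-\pi_Q(y)}{\pi_Q(y)}\right|\le\varepsilon\right\}.$$ *)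

(* Defs.v *)
From HB Require Import structures.
From mathcomp Require Import all_boot all_order all_algebra all_fingroup.
From mathcomp Require Import all_classical all_reals all_analysis.
Set Implicit Arguments.
Unset Strict Implicit.
Unset Printing Implicit Defensive.
Import Order.TTheory GRing.Theory Num.Theory.
Import numFieldNormedType.Exports.
Local Open Scope ring_scope.

(* Combinatorial description of an embedded graph with a root. The elements
   of D are the darts (oriented edges); [eperm] reverses a dart, [vperm] sends
   a dart to the next one counterclockwise around its origin, so that
   [vperm \o eperm] follows the boundary of the face to the right of a dart.
   The axioms are imposed by [planar_map] below. *)
Record rmap (D : finType) :=
  RMap { vperm : {perm D}; eperm : {perm D}; rootd : D }.

Section RMapFinite.
Variable D : finType.
Let rmap_to (m : rmap D) := (vperm m, eperm m, rootd m).
Let rmap_of (t : {perm D} * {perm D} * D) := RMap t.1.1 t.1.2 t.2.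
Let rmap_toK : cancel rmap_to rmap_of. Proof. by case. Qed.
HB.instance Definition _ := Finite.copy (rmap D) (can_type rmap_toK).
End RMapFinite.

Section Maps.
Variables (D : finType) (m : rmap D).

Definition vertices : {set {set D}} := porbits (vperm m).
Definition edges : {set {set D}} := porbits (eperm m).
(* Products of permutations compose from left to right. *)
Definition faces : {set {set D}} := porbits (eperm m * vperm m)%g.

Definition connected_map : bool :=
  [transitive <<[set vperm m; eperm m]>>%g, on [set: D] | 'P].

(* The last condition is Euler's formula, i.e. genus 0. *)
Definition planar_map : bool :=
  [&& [forall d, (eperm m d != d) && (eperm m (eperm m d) == d)],
      connected_map
    & #|vertices| + #|faces| == #|edges| + 2]%N.

Definition quadrangulation : bool :=
  planar_map && [forall f in faces, #|f| == 4].

(* A vertex is the set of darts leaving it, so its degree is its cardinal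
   (a loop contributes 2). *)
Definition deg (x : {set D}) : nat := #|x|.

Definition mult (x y : {set D}) : nat :=
  #|[set e in edges | [exists d in e, (d \in x) && (eperm m d \in y)]]|.

End Maps.

Section LazyWalk.
Variables (R : realType) (D : finType) (m : rmap D).

Definition lazy_p (x y : {set D}) : R :=
  if x == y then 1 / 2 else (mult m x y)%:R / (2 * (deg x)%:R).

Fixpoint lazy_pn (k : nat) (x y : {set D}) : R :=
  if k is k'.+1 then \sum_(z in vertices m) lazy_p x z * lazy_pn k' z y
  else (x == y)%:R.

Definition stationary (x : {set D}) : R := (deg x)%:R / (4 * #|faces m|%:R).

Definition mixed (eps : R) (k : nat) : Prop :=
  forall x y, x \in vertices m -> y \in vertices m ->
    `|(lazy_pn k x y - stationary y) / stationary y| <= eps.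

(* Extended-real valued, so that the infimum of the empty set is +oo. *)
Definition mixing_time (eps : R) : \bar R :=
  ereal_inf [set (k%:R)%:E | k in [set k : nat | mixed eps k]]%classic.

End LazyWalk.

(* Orientation-preserving homeomorphisms respecting the root are, on darts,
   the bijections commuting with both permutations and fixing the root. *)
Definition map_iso (D : finType) : rel (rmap D) := fun m1 m2 =>
  [exists f : {perm D},
    [&& [forall d, f (vperm m1 d) == vperm m2 (f d)],
        [forall d, f (eperm m1 d) == eperm m2 (f d)]
      & f (rootd m1) == rootd m2]].

Lemma map_iso_equiv (D : finType) : equivalence_rel (@map_iso D).
Proof.
have refl : reflexive (@map_iso D).
  move=> m; apply/existsP; exists 1%g; rewrite !perm1 eqxx andbT.
  by apply/andP; split; apply/forallP => d; rewrite !perm1.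
have sym m1 m2 : map_iso m1 m2 -> map_iso m2 m1.
  case/existsP => f /and3P[/forallP fv /forallP fe /eqP fr].
  apply/existsP; exists f^-1%g; rewrite -fr permK eqxx andbT.
  apply/andP; split; apply/forallP => d; apply/eqP/(@perm_inj _ f).
    by rewrite permKV (eqP (fv _)) permKV.
  by rewrite permKV (eqP (fe _)) permKV.
have trans m1 m2 m3 : map_iso m1 m2 -> map_iso m2 m3 -> map_iso m1 m3.
  case/existsP => f /and3P[/forallP fv /forallP fe /eqP fr].
  case/existsP => g /and3P[/forallP gv /forallP ge /eqP gr].
  apply/existsP; exists (f * g)%g; rewrite !permM fr gr eqxx andbT.
  apply/andP; split; apply/forallP => d; rewrite !permM.
    by rewrite (eqP (fv _)) (eqP (gv _)).
  by rewrite (eqP (fe _)) (eqP (ge _)).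
move=> m1 m2 m3; split; first exact: refl.
by move=> h; apply/idP/idP; [apply: trans; apply: sym | apply: trans].
Qed.

Lemma porbits_imset (D : finType) (f s t : {perm D}) :
  (forall d, f (s d) = t (f d)) -> porbits t = [set f @: (x : {set D}) | x in porbits s].
Proof.
move=> h.
have hX i d : f ((s ^+ i)%g d) = (t ^+ i)%g (f d).
  elim: i => [|i IH]; first by rewrite !expg0 !perm1.
  by rewrite !expgSr !permM h IH.
have ho d : porbit t (f d) = f @: porbit s d.
  apply/setP => e; apply/porbitP/imsetP => [[i ->]|[x /porbitP[i ->] ->]].
    by exists ((s ^+ i)%g d); rewrite ?mem_porbit // hX.
  by exists i; rewrite hX.
apply/setP => y; apply/imsetP/imsetP => [[d _ ->]|[x /imsetP[d _ ->] ->]].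
  exists (porbit s (f^-1%g d)); first by apply/imsetP; exists (f^-1%g d).
  by rewrite -ho permKV.
by exists (f d); rewrite ?ho.
Qed.

Lemma mixing_time_iso (R : realType) (D : finType) (m1 m2 : rmap D) (eps : R) :
  map_iso m1 m2 -> mixing_time m1 eps = mixing_time m2 eps.
Proof.
case/existsP => f /and3P[/forallP fv /forallP fe _].
have If : injective (fun x : {set D} => f @: x) by apply/imset_inj/perm_inj.
have hv : vertices m2 = [set f @: (x : {set D}) | x in vertices m1].
  by apply: porbits_imset => d; apply/eqP/fv.
have he : edges m2 = [set f @: (x : {set D}) | x in edges m1].
  by apply: porbits_imset => d; apply/eqP/fe.
have hf : faces m2 = [set f @: (x : {set D}) | x in faces m1].
  apply: porbits_imset => d.
  by rewrite !permM (eqP (fv _)) (eqP (fe _)).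
have fin d (x : {set D}) : (f d \in f @: x) = (d \in x) by rewrite mem_imset //; exact: perm_inj.
have hdeg (x : {set D}) : deg (f @: x) = deg x by apply/card_imset/perm_inj.
have hmult (x y : {set D}) : mult m2 (f @: x) (f @: y) = mult m1 x y.
  rewrite /mult -[RHS](card_imset _ If); congr (#|pred_of_set _|).
  have q (e : {set D}) : [exists d in f @: e, (d \in f @: x) && (eperm m2 d \in f @: y)]
           = [exists d in e, (d \in x) && (eperm m1 d \in y)].
    apply/existsP/existsP => [[d /and3P[/imsetP[c ce ->]]]|[d /and3P[de dx dy]]].
      by rewrite -(eqP (fe _)) !fin => cx cy; exists c; rewrite ce cx.
    by exists (f d); rewrite -(eqP (fe _)) !fin de dx.
  apply/setP => e'; rewrite he inE; apply/andP/imsetP.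
    by case=> /imsetP[e ee ->]; rewrite q => h; exists e; rewrite // inE ee.
  case=> e; rewrite inE => /andP[ee h] ->; rewrite q; split=> //.
  exact: imset_f.
have hp (x y : {set D}) : lazy_p R m2 (f @: x) (f @: y) = lazy_p R m1 x y.
  by rewrite /lazy_p (inj_eq If) hmult hdeg.
have hpn k (x y : {set D}) : lazy_pn R m2 k (f @: x) (f @: y) = lazy_pn R m1 k x y.
  elim: k x y => [|k IH] x y /=; first by rewrite (inj_eq If).
  rewrite hv big_imset /=; last by move=> ? ? _ _; exact: If.
  by apply: eq_bigr => z _; rewrite hp IH.
have hs (x : {set D}) : stationary R m2 (f @: x) = stationary R m1 x.
  by rewrite /stationary hdeg hf card_imset.
rewrite /mixing_time; congr (ereal_inf (image _ _)).
apply/funext => k; apply/propext; split=> h x y; last first.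
  by move=> xv yv; rewrite -!hs -!hpn; apply: h; rewrite hv imset_f.
rewrite hv => /imsetP[x' xv ->] /imsetP[y' yv ->]; rewrite hpn !hs; exact: h.
Qed.

(* Rooted quadrangulations with n faces, as isomorphism classes. Each of the n
   faces has 4 darts and the faces partition the darts, whence 'I_(4 * n). *)
Definition rooted_quads (n : nat) : {set {set rmap 'I_(4 * n)}} :=
  equivalence_partition (@map_iso _)
    [set m : rmap 'I_(4 * n) | quadrangulation m && (#|faces m| == n)].

(* Probability, for a uniform element of [rooted_quads n], of an event E
   invariant under [map_iso] (as in [mixing_time_iso]), read off any
   representative of the class. *)
Definition quad_prob (R : realType) (n : nat) (E : rmap 'I_(4 * n) -> Prop) : R :=
  #|[set C in rooted_quads n | `[< exists2 m, m \in C & E m >]]|%:R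
    / #|rooted_quads n|%:R.

(* Main.v *)
Require Import Defs.
From HB Require Import structures.
From mathcomp Require Import all_boot all_order all_algebra all_fingroup.
From mathcomp Require Import all_classical all_reals all_analysis.
From mathcomp Require Import zify ring lra.
Set Implicit Arguments.
Unset Strict Implicit.
Unset Printing Implicit Defensive.
Import Order.TTheory GRing.Theory Num.Theory.
Import numFieldNormedType.Exports.
Local Open Scope ring_scope.

(** Two estimates give the theorem.

    The walk.  Let every vertex of a quadrangulation with n faces be at distance
    at most M from some vertex z.  The increment of a function along a geodesic
    to z is controlled, by Cauchy-Schwarz, by M times the sum of its squared
    increments over all edges; this is a Poincare inequality ([poincare]) and
    bounds the spectral gap of the lazy walk below by 1 / (8 n M).  As laziness
    makes the transition operator positive, the gap governs its powers
    ([lazy_contracts]), and k steps mix as soon as n^2 exp (- k / (8 n M)) is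
    small ([mixed_of_radius]).  With M = n^(1/2 + delta/2) and
    k = n^(3/2 + delta) the exponent is of order n^(delta/2).

    The radius.  That a typical quadrangulation has radius at most
    n^(1/2 + delta/2) follows from Schaeffer's correspondence with labelled
    trees, carried out here on darts.  Label each vertex by its distance to z.
    Each face then has exactly two descending darts; join their origins inside
    the face.  The 2n descending darts become the corners of a plane tree with n
    edges, whose labels vary by at most one along an edge.  To see that the
    outcome is a tree, follow its contour from a descending dart g: the first
    corner of smaller label that it meets is the corner that g points to
    ([lower_hitP]).  Hence every cycle of the contour passes by a dart that
    points to z; two successive darts pointing to z lie on one cycle, so the
    contour is a single cycle ([contour_single]), and Euler's formula does the
    rest ([labelling_coded]).

    Conversely the map is recovered from the contour and the labels, since each
    dart points to the next corner of smaller label: this makes the code of a map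
    injective ([coded_iso], [coded_unique]), and every labelled tree is the code
    of a quadrangulation ([coded_quad], [coded_exists]).  On a given tree the
    labels are n free increments in {-1, 0, 1}, so the label of a corner is a sum
    of at most n independent centred variables and exceeds n^(1/2 + delta/2) / 2
    with a probability of order at most exp (- n^(delta/2) / 4)
    ([tree_label_tail]).  A class of maps has at most 8n codes ([card_codes]) and
    a class of large diameter has a code with a large label ([card_far_classes]);
    as the bound on the labels holds tree by tree, the number of plane trees
    cancels from the quotient.

    One fact of topology enters, twice: on a planar map, an antisymmetric
    function on the darts whose sum around each face vanishes is a gradient
    ([closed_form_exact]).  Over the field with two elements it makes
    quadrangulations bipartite, so that labels of neighbours differ by exactly
    one; over the rationals, on a map with one face, it says that increments on
    the edges of a tree can be integrated. *)

(** * Permutation orbits and closed forms on planar maps *)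

Section InvariantFunctions.
Variables (D : finType).

Lemma porbit_inv (S : Type) (s : {perm D}) (F : D -> S) :
  (forall d, F (s d) = F d) -> forall x y, x \in porbit s y -> F x = F y.
Proof.
move=> h x y /porbitP[i ->]; elim: i => [|i IH]; first by rewrite expg0 perm1.
by rewrite expgSr permM h.
Qed.

(** Vertices are bounded below by exhibiting enough values of a function constant
    around each vertex. *)
Lemma card_porbits_ge (S : finType) (s : {perm D}) (F : D -> S) (A : {set S}) :
  (forall d, F (s d) = F d) -> (forall a, a \in A -> exists d, F d = a) ->
  (#|A| <= #|porbits s|)%N.
Proof.
move=> hF hA; have [d0|D0] := pickP (fun d : D => true); last first.
  by rewrite (_ : A = finset.set0) ?cards0 //; apply/setP => a; rewrite inE;
     apply/negP => /hA[d _]; have := D0 d.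
move=> _; pose g (X : {set D}) := F (odflt d0 [pick x in X]).
have gF d : g (porbit s d) = F d.
  rewrite /g; case: pickP => [x xd|/(_ d)]; last by rewrite porbit_id.
  exact: porbit_inv xd.
apply: leq_trans (leq_imset_card g _); apply: subset_leq_card.
apply/fintype.subsetP => a /hA[d <-]; rewrite -gF; apply: imset_f; exact: imset_f.
Qed.

Lemma porbit_step (s : {perm D}) d : porbit s (s d) = porbit s d.
Proof. by have := porbit_perm s 1 d; rewrite expg1. Qed.

Lemma porbits_partition (s : {perm D}) : finset.partition (porbits s) [set: D]%SET.
Proof.
have -> : porbits s = orbit 'P <[s]> @: [set: D]%SET.
  by apply/setP => X; apply/imsetP/imsetP => -[x _ ->]; exists x; rewrite // porbitE.
by apply: orbit_partition; apply/fintype.subsetP => a _; rewrite !inE; apply/fintype.subsetP=> x _; rewrite !inE.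
Qed.

Lemma card_porbits_uniform (s : {perm D}) (k : nat) :
  (forall d, #|porbit s d| = k) -> (#|porbits s| * k)%N = #|D|.
Proof.
move=> h; rewrite -cardsT; have P := porbits_partition s.
by rewrite (@card_uniform_partition _ k (porbits s) [set: D]%SET) // => X /imsetP[d _ ->].
Qed.

End InvariantFunctions.

Lemma iter_pback (D : finType) (s : {perm D}) x y : y \in porbit s x ->
  exists k, y = iter k.+1 s x.
Proof.
case/porbitP => i ->; rewrite permX; case: i => [|i]; last by exists i.
exists #|porbit s x|.-1; rewrite prednK ?iter_porbit //.
by rewrite lt0n card_porbit_neq0.
Qed.

Lemma porbit_iter (D : finType) (s : {perm D}) k x : iter k s x \in porbit s x.
Proof. by rewrite -permX mem_porbit. Qed.

Lemma iter_pinv (D : finType) (s : {perm D}) k x : iter k s^-1%g (iter k s x) = x.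
Proof. by elim: k x => // k IH x; rewrite iterSr iterS permK IH. Qed.

Lemma porbit_involution (D : finType) (s : {perm D}) d :
  s (s d) = d -> porbit s d = [set d; s d].
Proof.
move=> sK; apply/setP => x; rewrite !inE; apply/porbitP/orP => [[i ->]|[]/eqP ->].
- elim: i => [|i]; first by rewrite expg0 perm1 eqxx; left.
  by rewrite expgSr permM => -[]/eqP ->; [right|left]; rewrite ?sK.
- by exists 0%N; rewrite expg0 perm1.
- by exists 1%N; rewrite expg1.
Qed.

Lemma card_porbit4 (D : finType) (s : {perm D}) d :
  s (s (s (s d))) = d -> s (s d) != d -> #|porbit s d| = 4.
Proof.
move=> s4 s2.
have -> : porbit s d = [set x in [:: d; s d; s (s d); s (s (s d))]].
  apply/setP => x; rewrite inE; apply/idP/idP.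
    case/porbitP => i ->; elim: i => [|i]; first by rewrite expg0 perm1 mem_head.
    rewrite expgSr permM !inE => /or4P[]/eqP ->; by rewrite ?s4 eqxx ?orbT.
  by rewrite !inE => /or4P[]/eqP ->; [exact: (porbit_iter s 0)|exact: (porbit_iter s 1)
    |exact: (porbit_iter s 2)|exact: (porbit_iter s 3)].
have s1 : s d != d by apply: contraNneq s2 => E; rewrite !E.
have s3 : s (s (s d)) != d by apply: contraNneq s1 => E; rewrite -{1}E s4.
suff /card_uniqP U : uniq [:: d; s d; s (s d); s (s (s d))] by rewrite cardsE U.
rewrite /= !inE !negb_or !(inj_eq perm_inj).
by rewrite ![d == _]eq_sym s1 s2 s3.
Qed.

Lemma card_edges (D : finType) (m : rmap D) :
  (forall d, eperm m d != d /\ eperm m (eperm m d) = d) ->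
  (#|edges m| * 2)%N = #|D|.
Proof.
move=> eK; apply: card_porbits_uniform => d; have [e1 e2] := eK d.
by rewrite porbit_involution // cards2 eq_sym e1.
Qed.

Section Connected.
Variables (D : finType) (m : rmap D).
Local Notation v := (vperm m).
Local Notation e := (eperm m).

Lemma connected_inv (S : Type) (F : D -> S) : connected_map m ->
  (forall d, F (v d) = F d) -> (forall d, F (e d) = F d) -> forall x y, F x = F y.
Proof.
move=> C hv he x y.
have : y \in orbit 'P <<[set v; e]>>%g x.
  by rewrite (atransP C) // inE.
case/orbitP => g /gen_prodgP[n [c hc ->]] <-.
elim: n c hc => [|n IH] c hc; first by rewrite big_ord0 act1.
rewrite big_ord_recr /= actM -/(aperm _ _) /aperm.
have := hc ord_max; rewrite !inE => /orP[]/eqP ->; rewrite ?hv ?he; apply: IH => i; exact: hc.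
Qed.

Lemma inv_connected (z : D) :
  (forall A : {set D}, z \in A -> (forall d, (v d \in A) = (d \in A)) ->
     (forall d, (e d \in A) = (d \in A)) -> A = [set: D]%SET) -> connected_map m.
Proof.
move=> h; rewrite /connected_map.
have K (s : {perm D}) d : s \in [set v; e] ->
    (s d \in orbit 'P <<[set v; e]>>%g z) = (d \in orbit 'P <<[set v; e]>>%g z).
  move=> sS; apply: (@orbit_transl _ _ _ _ _).
  by apply: (mem_orbit 'P); apply: mem_gen.
apply/imsetP; exists z; first by rewrite inE.
apply/esym/h; first exact: orbit_refl.
  by move=> d; apply: K; rewrite !inE eqxx.
by move=> d; apply: K; rewrite !inE eqxx orbT.
Qed.

End Connected.

Section Exactness.
Variables (K : fieldType) (D : finType) (m : rmap D).
Hypothesis eK : forall d, eperm m d != d /\ eperm m (eperm m d) = d.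
Hypothesis conn : connected_map m.
Variable d0 : D.
Local Notation v := (vperm m).
Local Notation e := (eperm m).
Local Notation f := (e * v)%g.

Let nv := #|vertices m|.
Let ne := #|edges m|.
Let nf := #|faces m|.

(** An arbitrary orientation of the edges; a coboundary matrix needs one. *)
Let rep (j : 'I_ne) : D := odflt d0 [pick d in enum_val j].

Let edgeE d : porbit e d = [set d; e d].
Proof. by apply: porbit_involution; have [] := eK d. Qed.

Let rep_edge j : enum_val j = [set rep j; e (rep j)].
Proof.
have /imsetP[d _ E] := enum_valP j; rewrite /rep; case: pickP => [x|/(_ d)]; last first.
  by rewrite E porbit_id.
rewrite {1}E -eq_porbit_mem => /eqP Ex.
by rewrite E -Ex edgeE.
Qed.

Let sum_rep (G : D -> K) : \sum_j (G (rep j) + G (e (rep j))) = \sum_d G d.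
Proof.
have P := porbits_partition e.
transitivity (\sum_(d in [set: D]%SET) G d); last by apply: eq_bigl => d; rewrite inE.
rewrite (set_partition_big _ P) /= (big_enum_val (fun X : {set D} => \sum_(d in X) G d)).
apply: eq_bigr => j _; rewrite rep_edge big_setU1 ?big_set1 // inE eq_sym.
by have [] := eK (rep j).
Qed.

Let ind (p : {perm D}) (i : 'I_#|porbits p|) (d : D) : K := (d \in enum_val i)%:R.

Let indS (p : {perm D}) i d : @ind p i (p d) = ind i d.
Proof.
have /imsetP[x _ E] := enum_valP i; rewrite /ind E; congr (_%:R).
by rewrite -!eq_porbit_mem porbit_step.
Qed.

Let A : 'M[K]_(nv, ne) := \matrix_(i, j) (ind i (e (rep j)) - ind i (rep j)).
Let B : 'M[K]_(ne, nf) := \matrix_(j, i) (@ind f i (rep j) - ind i (e (rep j))).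

(** The coboundary of a coboundary vanishes. *)
Let AB0 : A *m B = 0.
Proof.
apply/matrixP => i k; rewrite !mxE.
pose a d := ind i (e d) - ind i d.
under eq_bigr => j _ do rewrite !mxE.
transitivity (\sum_d a d * @ind f k d).
  rewrite -sum_rep; apply: eq_bigr => j _.
  by rewrite /a (eK _).2; ring.
have -> : \sum_d a d * @ind f k d =
   \sum_d ind i (f d) * @ind f k (f d) - \sum_d ind i d * @ind f k d.
  rewrite -sumrB; apply: eq_bigr => d _; rewrite (indS k) permM (indS i) /a; ring.
by rewrite [X in _ - X](reindex_inj (@perm_inj _ f)) subrr.
Qed.

Let idx (p : {perm D}) d : {i : 'I_#|porbits p| | enum_val i = porbit p d}.
Proof.
have oP : porbit p d \in porbits p by apply: imset_f.
by exists (enum_rank_in oP (porbit p d)); rewrite enum_rankK_in.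
Qed.

Let pull (p : {perm D}) (u : 'rV[K]_#|porbits p|) (d : D) : K := u 0 (sval (idx p d)).

Let pullS p u d : @pull p u (p d) = pull u d.
Proof.
rewrite /pull; congr (u 0 _); apply: enum_val_inj.
by rewrite (svalP (idx p d)) (svalP (idx p (p d))) porbit_step.
Qed.

Let pull_sum p (u : 'rV[K]_#|porbits p|) d : \sum_i u 0 i * ind i d = pull u d.
Proof.
rewrite /pull; have /= E0 := svalP (idx p d); move: (sval _) E0 => i0 E0.
rewrite (bigD1 i0) //= big1 => [|i ni].
  by rewrite addr0 /ind E0 porbit_id mulr1.
rewrite /ind; have [xi|] := boolP (d \in enum_val i); last by rewrite mulr0.
case/eqP: ni; apply: enum_val_inj; rewrite E0.
have /imsetP[y _ Ey] := enum_valP i.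
by apply/eqP; rewrite Ey eq_sym eq_porbit_mem -Ey.
Qed.

Let rep_ex d : exists j, d = rep j \/ d = e (rep j).
Proof.
have [j Ej] := idx e d; exists j.
have : d \in [set rep j; e (rep j)] by rewrite -rep_edge Ej porbit_id.
by rewrite !inE => /orP[]/eqP; [left|right].
Qed.

(** The kernel of a coboundary matrix is made of the constants, the map being
    connected: its rank misses the number of orbits by one. *)
Let rank_const (p : {perm D}) n (M : 'M[K]_(#|porbits p|, n)) :
  (forall (u : 'rV_(#|porbits p|)), u *m M = 0 -> forall x y, pull u x = pull u y) ->
  (#|porbits p| - 1 <= \rank M)%N.
Proof.
move=> h.
have kc : (kermx M <= (const_mx 1 : 'rV[K]_(#|porbits p|)))%MS.
  apply/row_subP => r; set u : 'rV_#|porbits p| := row r (kermx M).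
  have u0 : u *m M = 0 by apply/sub_kermxP; rewrite row_sub.
  have -> : u = pull u d0 *: const_mx 1.
    apply/rowP => i; rewrite [RHS]mxE [X in _ * X]mxE mulr1.
    have /imsetP[x _ Ex] := enum_valP i.
    rewrite (h u u0 d0 x) /pull.
    suff -> : sval (idx p x) = i by [].
    by apply: enum_val_inj; rewrite (svalP (idx p x)) Ex.
  exact: scalemx_sub (submx_refl _).
have := leq_trans (mxrankS kc) (rank_leq_row _).
by rewrite mxrank_ker; lia.
Qed.

Let rankA : (nv - 1 <= \rank A)%N.
Proof.
apply: rank_const => u uA; apply: (connected_inv conn) => d; first exact: pullS.
have [j jd] := rep_ex d.
have /rowP/(_ j) := uA; rewrite !mxE.
under eq_bigr => i _ do rewrite !mxE mulrBr.
rewrite sumrB !pull_sum => /eqP; rewrite subr_eq0 => /eqP Er.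
by case: jd => ->; rewrite ?(eK _).2.
Qed.

Let rankB : (nf - 1 <= \rank B)%N.
Proof.
rewrite -mxrank_tr; apply: rank_const => u uA.
have Ge d : pull u (e d) = pull u d.
  have [j jd] := rep_ex d.
  have /rowP/(_ j) := uA; rewrite !mxE.
  under eq_bigr => i _ do rewrite !mxE mulrBr.
  rewrite sumrB !pull_sum => /eqP; rewrite subr_eq0 => /eqP Er.
  by case: jd => ->; rewrite ?(eK _).2.
apply: (connected_inv conn) => // d.
by have := pullS u (e d); rewrite permM (eK _).2 Ge.
Qed.

(** The genus is nonnegative, because the composite of the two coboundaries
    vanishes. *)
Lemma euler_le : (#|vertices m| + #|faces m| <= #|edges m| + 2)%N.
Proof.
have := mulmx0_rank_max AB0; have := rankA; have := rankB.
by rewrite /nv /ne /nf; lia.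
Qed.

(** In genus 0 the ranks add up: the gradients, of dimension one less than the
    number of vertices, fill the kernel of the second coboundary. *)
Lemma closed_form_exact (w : D -> K) :
  (#|vertices m| + #|faces m| = #|edges m| + 2)%N ->
  (forall d, w (e d) = - w d) ->
  (forall F, F \in faces m -> \sum_(d in F) w d = 0) ->
  exists h : D -> K, (forall d, h (v d) = h d) /\ (forall d, h (e d) - h d = w d).
Proof.
move=> eul we wF; pose W : 'rV[K]_ne := \row_j w (rep j).
have WB : W *m B = 0.
  apply/rowP => i; rewrite !mxE -[RHS](wF (enum_val i)) ?enum_valP //.
  rewrite [RHS]big_mkcond /= -sum_rep; apply: eq_bigr => j _; rewrite !mxE /ind we.
  by case: (rep j \in _); case: (e (rep j) \in _) => /=; ring.
have AB : (A <= kermx B)%MS by apply/sub_kermxP/AB0.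
have : (W <= A)%MS.
  apply: (@submx_trans _ _ _ _ _ _ (kermx B)); first exact/sub_kermxP.
  rewrite -(mxrank_leqif_sup AB) mxrank_ker.
  have := rankA; have := rankB; have := mxrankS AB; rewrite mxrank_ker /nv /nf /ne; lia.
case/submxP => h hE.
exists (pull h); split=> d; first exact: pullS.
have [j jd] := rep_ex d.
have /rowP/(_ j) := hE; rewrite !mxE.
under eq_bigr => i _ do rewrite !mxE mulrBr.
rewrite sumrB !pull_sum => Er.
by case: jd => ->; rewrite ?(eK _).2 // we Er opprB.
Qed.

End Exactness.

(** * Distance labellings of quadrangulations *)

Section FirstHit.
Variables (T : Type) (f : T -> T) (P : pred T).

(** The first point after x, x excluded, of the f-orbit of x where P holds. *)
Definition first_hit (x : T) : T :=
  match pselect (exists k, P (iter k.+1 f x)) with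
  | left h => iter (ex_minn h).+1 f x
  | right _ => x
  end.

Lemma first_hitE j x : P (iter j.+1 f x) ->
  (forall i, (i < j)%N -> ~~ P (iter i.+1 f x)) -> first_hit x = iter j.+1 f x.
Proof.
move=> Pj hj; rewrite /first_hit; case: pselect => [h|[]]; last by exists j.
case: ex_minnP => k Pk kmin; congr (iter _.+1 f x).
have := kmin _ Pj; case: (ltngtP k j) => // kj; by rewrite (negPf (hj k kj)) in Pk.
Qed.

Lemma first_hitP k x : P (iter k.+1 f x) ->
  exists j, [/\ (j <= k)%N, first_hit x = iter j.+1 f x, P (iter j.+1 f x)
    & forall i, (i < j)%N -> ~~ P (iter i.+1 f x)].
Proof.
move=> Pk; have h : exists k, P (iter k.+1 f x) by exists k.
case: (ex_minnP h) => j Pj jmin; exists j.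
have hj i : (i < j)%N -> ~~ P (iter i.+1 f x).
  by move=> ij; apply/negP => /jmin; rewrite leqNgt ij.
by split=> //; [exact: jmin | exact: first_hitE].
Qed.

Lemma first_hit_step x : ~~ P (f x) -> (exists k, P (iter k.+1 f x)) ->
  first_hit x = first_hit (f x).
Proof.
move=> Px [k /first_hitP[[|j] [_ -> Pj jmin]]]; first by rewrite Pj in Px.
rewrite iterSr in Pj *; apply/esym/first_hitE => // i ij.
by rewrite -iterSr; apply: jmin.
Qed.

End FirstHit.

Section QuadFacts.
Variables (D : finType) (m : rmap D).
Local Notation v := (vperm m).
Local Notation e := (eperm m).
Local Notation f := (e * v)%g.

Lemma planar_eK : planar_map m -> forall d, e d != d /\ e (e d) = d.
Proof. by case/and3P=> /forallP h _ _ d; have /andP[-> /eqP ->] := h d. Qed.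

Hypothesis Q : quadrangulation m.

Lemma quad_planar : planar_map m. Proof. by case/andP: Q. Qed.

Lemma quad_card4 d : #|porbit f d| = 4.
Proof. by case/andP: Q => _ /forallP/(_ (porbit f d))/implyP/(_ _)/eqP; apply; apply: imset_f. Qed.

Lemma quad_face d : [/\ f (f (f (f d))) = d, f d != d, f (f d) != d & f (f (f d)) != d].
Proof.
have c4 := quad_card4 d.
have := uniq_traject_porbit f d; have := iter_porbit f d; rewrite c4 /= !inE.
by rewrite !negb_or -!andbA => -> /andP[h1 /andP[h2 /andP[h3 _]]]; rewrite ![_ == d]eq_sym.
Qed.

(** The constant 1 over the field with two elements is antisymmetric and sums to
    4 = 0 around each face, hence is a gradient. *)
Lemma quad_bipartite : exists h : D -> bool,
  (forall d, h (v d) = h d) /\ (forall d, h (e d) = ~~ h d).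
Proof.
have P := quad_planar; have eK := planar_eK P; have /and3P[_ C /eqP eul] := P.
have [d0 _|D0] := pickP (fun d : D => true); last by exists (fun=> true); split=> d; have := D0 d.
have [||h [hv he]] := @closed_form_exact 'F_2 D m eK C d0 (fun=> 1) eul.
- by move=> d; apply/eqP.
- move=> F /imsetP[d _ ->]; rewrite sumr_const.
  by rewrite quad_card4; apply/eqP.
exists (fun d => h d == 0); split=> d; first by rewrite hv.
have -> : h (e d) = h d + 1 by rewrite -(he d) addrC subrK.
by case: (h d) => [[|[|k]] hk].
Qed.

End QuadFacts.

(** The distance to the vertex of z, up to a constant, characterized locally:
    labels change by one along each edge and only the vertex of z has no lower
    neighbour. *)
Record labelling (D : finType) (m : rmap D) (L : D -> int) (z : D) : Prop := Labelling {
  lab_v : forall d, L (vperm m d) = L d;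
  lab_e : forall d, L (eperm m d) = L d + 1 \/ L (eperm m d) = L d - 1;
  lab_desc : forall d, d \notin porbit (vperm m) z ->
    exists2 d', d' \in porbit (vperm m) d & L (eperm m d') < L d' }.

Section Labelling.
Variables (D : finType) (m : rmap D).
Local Notation v := (vperm m).
Local Notation e := (eperm m).

Lemma labelling_exists (z : D) : quadrangulation m ->
  exists L, labelling m L z.
Proof.
move=> Q; have P := quad_planar Q; have eK := planar_eK P; have /and3P[_ C _] := P.
have [h [hv he]] := quad_bipartite Q.
pose fix B k : {set D} := if k is k'.+1
  then [set d | [exists d' in porbit v d, (d' \in B k') || (e d' \in B k')]]
  else porbit v z.
have Bv k d : (v d \in B k) = (d \in B k).
  by case: k => [|k] /=; rewrite ?inE ?porbit_step // -!eq_porbit_mem porbit_step.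
have Bv' k d d' : d' \in porbit v d -> (d' \in B k) = (d \in B k).
  by apply: (@porbit_inv _ _ v (fun d => d \in B k)).
have Be k d : d \in B k -> e d \in B k.+1.
  move=> dB; rewrite inE; apply/existsP; exists (e d).
  by rewrite porbit_id (eK d).2 dB orbT.
have Bex d : exists k, d \in B k.
  apply/asboolP; rewrite (@connected_inv _ m _ (fun d => `[<exists k, d \in B k>]) C _ _ d z).
  - by apply/asboolP; exists 0%N; apply: porbit_id.
  - by move=> x; apply: asbool_equiv_eq; split=> -[k]; exists k; rewrite ?Bv // -Bv.
  - move=> x; apply: asbool_equiv_eq; split=> -[k xk]; exists k.+1; last exact: Be.
    by rewrite -[x](eK x).2; apply: Be.
pose dist d := ex_minn (Bex d).
have distB d : d \in B (dist d) by rewrite /dist; case: ex_minnP.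
have distmin d k : d \in B k -> (dist d <= k)%N by rewrite /dist; case: ex_minnP => ? ? h' /h'.
have distv d d' : d' \in porbit v d -> dist d' = dist d.
  move=> dd'; apply/eqP; rewrite eqn_leq; apply/andP; split; apply: distmin.
    by rewrite (Bv' _ _ _ dd').
  by rewrite -(Bv' _ _ _ dd').
have diste d : (dist (e d) <= (dist d).+1)%N by apply/distmin/Be.
have pred d k : dist d = k.+1 -> exists2 d', d' \in porbit v d & dist (e d') = k.
  move=> dk; have := distB d; rewrite dk inE => /existsP[d' /andP[dd' /orP[dB|dB]]].
    by have := distmin _ _ dB; rewrite (distv _ _ dd') dk ltnn.
  exists d' => //; have := distmin _ _ dB; have := diste (e d').
  rewrite (eK d').2 (distv _ _ dd') dk; lia.
have par k d : dist d = k -> odd k = (h d != h z).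
  elim: k d => [|k IH] d dk.
    by have := distB d; rewrite dk /= => /(porbit_inv hv) ->; rewrite eqxx.
  have [d' dd' dk'] := pred d k dk.
  rewrite -(porbit_inv hv dd') /= (IH _ dk') he.
  by case: (h d'); case: (h z).
exists (fun d => (dist d)%:Z); split=> [d|d|d dz].
- by rewrite (distv d (v d)) // -(porbit_step v d) porbit_id.
- have := diste d; have := diste (e d); rewrite (eK d).2.
  have : dist d != dist (e d).
    apply/eqP => E; have := par _ (e d) erefl; rewrite -E (par _ d erefl) he.
    by case: (h d); case: (h z).
  lia.
- case E : (dist d) => [|k]; first by have := distB d; rewrite E /= (negPf dz).
  have [d' dd' dk] := pred _ _ E; exists d' => //.
  by rewrite dk (distv _ _ dd') E; lia.
Qed.

Variables (L : D -> int) (z : D).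
Hypothesis lab : labelling m L z.

Lemma lab_orbit d d' : d' \in porbit v d -> L d' = L d.
Proof. exact: (porbit_inv (lab_v lab)). Qed.

Lemma lab_min d : L z <= L d.
Proof.
have [x _ xm] := @arg_minP _ int D z predT L isT.
apply: le_trans (xm d isT).
have [/lab_orbit -> //|/(lab_desc lab)[x' xx' h]] := boolP (x \in porbit v z).
by have := xm (eperm m x') isT; rewrite -(lab_orbit xx'); lia.
Qed.

Lemma lab_z d : d \in porbit v z -> L (e d) = L d + 1.
Proof. by move=> dz; have := lab_min (e d); have := lab_e lab d; rewrite (lab_orbit dz); lia. Qed.

End Labelling.

(** Applied both ways, it shows that two labellings with the same origin differ by
    a constant.  Where the difference is maximal, follow edges that descend for
    one labelling: the difference stays maximal, until z. *)
Lemma labelling_le (D : finType) (m : rmap D) L L' z z' : planar_map m ->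
  labelling m L z -> labelling m L' z' -> z' \in porbit (vperm m) z -> forall d, L d - L z <= L' d - L' z.
Proof.
move=> /planar_eK eK H H' zz d.
have [x _ xm] := @arg_maxP _ int D d predT (fun d => L d - L' d) isT.
have [y yx ym] := @arg_minP _ int D x (fun y => L y - L' y == L x - L' x) L' (eqxx _).
suff yz : y \in porbit (vperm m) z.
  by have := xm d isT; have := lab_orbit H yz; have := lab_orbit H' yz; move: yx; lia.
apply: contraT => ynz.
have [|y' yy' yd] := @lab_desc _ _ _ _ H' y.
  by rewrite -eq_porbit_mem in zz; rewrite -eq_porbit_mem (eqP zz) eq_porbit_mem.
have := lab_orbit H yy'; have := lab_orbit H' yy'.
have := lab_e H y'; have := lab_e H' y'; have := xm (eperm m y') isT.
have := ym (eperm m y'); move: yx yd => /eqP.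
case: eqP => [_ + + /(_ isT)|]; lia.
Qed.

(** * The contour of a labelled quadrangulation *)

Section Contour.
Variables (D : finType) (m : rmap D) (L : D -> int).
Local Notation v := (vperm m).
Local Notation e := (eperm m).

Definition desc (d : D) : bool := L (e d) < L d.
Definition face_next (d : D) : D := v (e d).
Local Notation phi := face_next.
(** The other descending dart of the face of d: the other end of the tree edge
    drawn in that face. *)
Definition mate (d : D) : D :=
  if desc (phi d) then phi d else if desc (phi (phi d)) then phi (phi d)
  else phi (phi (phi d)).
(** Turning clockwise around the origin of d, the next corner of the tree; an
    ascending dart lies in the corner so obtained. *)
Definition prev_desc (d : D) : D := first_hit v^-1%g desc d.
(** Follow the tree edge of the corner d, then turn to the next corner. *)
Definition contour (d : D) : D := prev_desc (mate d).

Variable (z : D).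
Hypothesis Q : quadrangulation m.
Hypothesis lab : labelling m L z.

Let eK d : e (e d) = d. Proof. by have [] := planar_eK (quad_planar Q) d. Qed.

Lemma desc_e d : desc (e d) = ~~ desc d.
Proof. by rewrite /desc eK; have := lab_e lab d; lia. Qed.

Lemma desc_level d : desc d -> L (e d) = L d - 1.
Proof. by rewrite /desc; have := lab_e lab d; lia. Qed.

Lemma asc_level d : ~~ desc d -> L (e d) = L d + 1.
Proof. by rewrite /desc; have := lab_e lab d; lia. Qed.

Lemma face_next_level d : L (phi d) = L (e d).
Proof. exact: (lab_v lab). Qed.

Lemma face_next4 d : phi (phi (phi (phi d))) = d.
Proof. by have [] := quad_face Q d; rewrite !permM. Qed.

Lemma face_next_neq d : [/\ phi d != d, phi (phi d) != d & phi (phi (phi d)) != d].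
Proof. by have [] := quad_face Q d; rewrite !permM. Qed.

(** Labels change by one along the four sides of a face and add up to 0. *)
Lemma face_pattern d : desc d ->
  [\/ [/\ desc (phi d), ~~ desc (phi (phi d)) & ~~ desc (phi (phi (phi d)))],
      [/\ ~~ desc (phi d), desc (phi (phi d)) & ~~ desc (phi (phi (phi d)))]
    | [/\ ~~ desc (phi d), ~~ desc (phi (phi d)) & desc (phi (phi (phi d)))]].
Proof.
move=> dd; have E x : L (phi x) = if desc x then L x - 1 else L x + 1.
  by rewrite face_next_level; case: ifPn => [/desc_level|/asc_level].
have := E (phi (phi (phi d))); rewrite face_next4 !E dd.
case: (boolP (desc (phi d))); case: (boolP (desc (phi (phi d)))); case: (boolP (desc (phi (phi (phi d)))));
  try lia; by [constructor 1|constructor 2|constructor 3].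
Qed.

Variant mate_spec d : Prop :=
| Mate1 of desc (phi d) & mate d = phi d & L (mate d) = L d - 1
| Mate2 of ~~ desc (phi d) & desc (phi (phi d)) & mate d = phi (phi d) & L (mate d) = L d
| Mate3 of ~~ desc (phi d) & ~~ desc (phi (phi d)) & mate d = phi (phi (phi d))
    & L (mate d) = L d + 1.

Lemma mateP d : desc d -> mate_spec d.
Proof.
move=> dd; have l1 := face_next_level d; have l2 := face_next_level (phi d).
have l3 := face_next_level (phi (phi d)); have l0 := desc_level dd.
case: (face_pattern dd) => -[h1 h2 h3].
- by constructor=> //; rewrite /mate h1 // l1 l0.
- by constructor 2=> //; rewrite /mate (negPf h1) h2 // l2 (asc_level h1) l1 l0; lia.
- constructor 3=> //; rewrite /mate (negPf h1) (negPf h2) // l3 (asc_level h2) l2.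
  by rewrite (asc_level h1) l1 l0; lia.
Qed.

Lemma desc_mate d : desc d -> desc (mate d).
Proof.
move=> dd; rewrite /mate; case: (face_pattern dd) => -[h1 h2 h3].
- by rewrite h1.
- by rewrite (negPf h1) h2.
- by rewrite (negPf h1) (negPf h2).
Qed.

Lemma mateK d : desc d -> mate (mate d) = d.
Proof.
move=> dd; rewrite /mate; case: (face_pattern dd) => -[h1 h2 h3].
- by rewrite h1 (negPf h2) (negPf h3) face_next4.
- by rewrite (negPf h1) h2 (negPf h3) face_next4 dd.
- by rewrite (negPf h1) (negPf h2) face_next4 dd.
Qed.

Lemma mate_neq d : mate d != d.
Proof. by rewrite /mate; have [] := face_next_neq d; case: ifP => // _; case: ifP. Qed.

Lemma prev_desc_here d : desc (v^-1%g d) -> prev_desc d = v^-1%g d.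
Proof. by move=> h; rewrite /prev_desc (@first_hitE _ _ _ 0). Qed.

Lemma prev_desc_exists d : d \notin porbit v z -> exists k, desc (iter k.+1 v^-1%g d).
Proof.
move=> /(lab_desc lab)[d' dd' h]; have := iter_pback (s := v^-1%g) (x := d) (y := d').
by rewrite porbitV => /(_ dd')[k E]; exists k; rewrite -E.
Qed.

Lemma desc_nz d d' : desc d -> d' \in porbit v d -> d' \notin porbit v z.
Proof.
move=> dd dd'; apply/negP => d'z.
have : d \in porbit v z by move: dd' d'z; rewrite -!eq_porbit_mem => /eqP <-.
by move=> /(lab_z lab); rewrite (desc_level dd); lia.
Qed.

Lemma prev_descP d : d \notin porbit v z ->
  desc (prev_desc d) /\ prev_desc d \in porbit v d.
Proof.
case/prev_desc_exists => k hk; have [j [_ E dj _]] := first_hitP hk; rewrite /prev_desc E; split=> //.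
by rewrite -(porbitV v) porbit_iter.
Qed.

Lemma contourP d : desc d -> desc (contour d) /\ L (contour d) = L (mate d).
Proof.
move=> /desc_mate h; have [|h1 h2] := @prev_descP (mate d).
  exact: desc_nz h (porbit_id _ _).
by split=> //; exact: (lab_orbit lab h2).
Qed.

Lemma contour_side d : desc d -> ~~ desc (phi d) -> desc (phi (phi d)) ->
  contour d = e (phi d).
Proof.
move=> dd h1 h2; case: (mateP dd) => [h|_ _ E _|_ h]; [by rewrite h in h1| |by rewrite h2 in h].
rewrite /contour E prev_desc_here; first by rewrite /face_next permK.
by rewrite {2}/face_next permK desc_e.
Qed.

Lemma contour_up d : desc d -> ~~ desc (phi d) -> ~~ desc (phi (phi d)) ->
  contour d = e (phi (phi d)).
Proof.
move=> dd h1 h2; case: (mateP dd) => [h|_ h|_ _ E _]; [by rewrite h in h1|by rewrite h in h2|].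
rewrite /contour E prev_desc_here; first by rewrite /face_next permK.
by rewrite {3}/face_next permK desc_e.
Qed.

(** The contour starting at g meets no lower corner before the one that g points
    to. *)
Definition lower_hit g := exists j, iter j.+1 contour g = prev_desc (e g) /\
  forall i, (i <= j)%N -> L g <= L (iter i contour g).

Definition reach_side g g' := exists j, iter j.+1 contour g = g' /\
  forall i, (0 < i <= j)%N -> L g < L (iter i contour g).

Lemma prev_desc_chain g : desc g -> e g \notin porbit v z -> ~~ desc (phi g) ->
  prev_desc (phi g) = prev_desc (e g).
Proof.
move=> dg gz h; rewrite /prev_desc first_hit_step /face_next ?permK ?desc_e ?dg //.
apply: prev_desc_exists; move: gz; rewrite -!eq_porbit_mem porbit_step; exact.
Qed.

(** A step up opens an excursion above the level of g; the assumption, for its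
    first corner, says where it returns. *)
Lemma reach_sideP g : desc g -> ~~ desc (phi g) ->
  (forall g', desc g' -> L g < L g' -> e g' \notin porbit v z -> lower_hit g') ->
  reach_side g (e (phi g)).
Proof.
move=> dg h1 IH; case: (boolP (desc (phi (phi g)))) => h2.
  exists 0%N => /=; rewrite contour_side //; split=> // i; lia.
have Eu := contour_up dg h1 h2; have [du _] := contourP dg.
have Lu : L (contour g) = L g + 1.
  by have [_ ->] := contourP dg; case: (mateP dg) => [h|_ h|//]; [rewrite h in h1|rewrite h in h2].
have hz : e (contour g) \notin porbit v z.
  rewrite Eu eK; apply: (@desc_nz (e (phi g))); first by rewrite desc_e.
  by rewrite -[phi (phi g)]/(v (e (phi g))) -eq_porbit_mem porbit_step.
have [|j [Ej hj]] := IH (contour g) du _ hz; first by lia.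
exists j.+1; rewrite iterSr Ej Eu eK; split.
  by rewrite prev_desc_here /face_next permK // desc_e.
by case=> // i /andP[_]; rewrite ltnS => ij; rewrite iterSr; have := hj i ij; lia.
Qed.

(** By descending induction on the level of g, and for a given level by induction
    on the number of darts between the reverse of g and the next descending dart
    of its target: the darts in between point to the same corner as g and are
    visited in turn by the contour. *)
Lemma lower_hitP g : desc g -> e g \notin porbit v z -> lower_hit g.
Proof.
(* M bounds all labels, so that M - L g measures the descent on levels. *)
have [M hM] : exists M, forall d, L d < M.
  have [x _ xm] := @arg_maxP _ int D z predT L isT.
  by exists (L x + 1) => d; have := xm d isT; lia.
have : M <= L g + `|M - L g|%N by lia.
move: `|_|%N => N; elim: N g => [|N IHN] g; first by have := hM g; lia.
move=> gN dg gz.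
have : exists k, desc (iter k.+1 v (e g)).
  by have [d' /iter_pback[k ->]] := lab_desc lab gz; exists k.
have IH g' : desc g' -> L g < L g' -> e g' \notin porbit v z -> lower_hit g'.
  by move=> dg' lg' gz'; apply: IHN => //; lia.
have {IHN gN} {}IH g' : L g <= L g' -> forall g'', desc g'' -> L g' < L g'' ->
    e g'' \notin porbit v z -> lower_hit g''.
  by move=> l1 g'' dg' l2 gz'; apply: IH => //; lia.
case=> k; elim: k g IH dg gz => [|k IHk] g IH dg gz; case: (boolP (desc (phi g))) => h1.
- move=> _; exists 0%N; split=> [|[]//] /=.
  case: (mateP dg) => [_ E _|/negP//|/negP//]; rewrite /contour E.
  rewrite /prev_desc first_hit_step /face_next ?permK ?desc_e ?dg //.
  apply: prev_desc_exists; move: gz; rewrite -!eq_porbit_mem porbit_step; exact.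
- by move=> h; case/negP: h1.
- move=> _; exists 0%N; split=> [|[]//] /=.
  case: (mateP dg) => [_ E _|/negP//|/negP//]; rewrite /contour E.
  rewrite /prev_desc first_hit_step /face_next ?permK ?desc_e ?dg //.
  apply: prev_desc_exists; move: gz; rewrite -!eq_porbit_mem porbit_step; exact.
- rewrite iterSr -/(phi g) => hk.
  have d1 : desc (e (phi g)) by rewrite desc_e.
  have Lg1 : L (e (phi g)) = L g.
    by rewrite (asc_level h1) face_next_level desc_level //; lia.
  have [j1 [E1 hj1]] := reach_sideP dg h1 (IH g (lexx _)).
  have [|||j2 [E2 hj2]] := IHk (e (phi g)) _ d1.
  + by rewrite Lg1.
  + by rewrite eK; move: gz; rewrite -!eq_porbit_mem porbit_step.
  + by rewrite eK.
  exists (j2 + j1.+1)%N; rewrite -addSn iterD E1 E2 eK prev_desc_chain //; split=> // i ij.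
  case: (ltnP i j1.+1) => ij1.
    by case: i ij ij1 => // i ij ij1; apply: ltW; apply: hj1; rewrite /= -ltnS.
  by rewrite -(subnK ij1) iterD E1 -Lg1; apply: hj2; lia.
Qed.

Lemma contour_next g : desc g -> ~~ desc (phi g) -> reach_side g (e (phi g)).
Proof. by move=> dg h; apply: reach_sideP => // g' ? _ ?; apply: lower_hitP. Qed.

Lemma first_hit_side g : desc g -> ~~ desc (phi g) ->
  first_hit contour (fun d => L d <= L g) g = e (phi g).
Proof.
move=> dg h; have [j [E hj]] := contour_next dg h; rewrite -E.
apply: first_hitE => [|i ij]; last by rewrite -ltNge; apply: hj.
by rewrite E (asc_level h) face_next_level desc_level //; lia.
Qed.

Lemma contour_inj : {in desc &, injective contour}.
Proof.
move=> x y dx dy; rewrite /contour => E.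
suff : mate x = mate y by move/(congr1 mate); rewrite !mateK.
move: E (desc_mate dx) (desc_mate dy); move: (mate x) (mate y) => a b E da db {x y dx dy}.
have exi a' : desc a' -> exists k, desc (iter k.+1 v^-1%g a').
  by move=> h; apply: prev_desc_exists; apply: desc_nz h (porbit_id _ _).
have [i [_ Ei di hi]] := first_hitP (projT2 (cid (exi a da))).
have [j [_ Ej dj hj]] := first_hitP (projT2 (cid (exi b db))).
wlog ij : a b da db i j E Ei di hi Ej dj hj / (i <= j)%N.
  move=> W; case: (leqP i j) => ij; first exact: (W a b da db i j).
  by apply/esym/(W b a db da j i) => //; apply: ltnW.
move: E; rewrite /prev_desc Ei Ej (_ : j.+1 = (i.+1 + (j - i))%N); last by lia.
rewrite iterD -!permX => /perm_inj; rewrite permX.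
case E: (j - i)%N => [//|k] Ea; move: da; rewrite Ea.
by have := hj k; rewrite (_ : (k < j)%N); [move=> /(_ isT)/negPf -> | lia].
Qed.

(** Extended by the identity, to be a permutation of all darts. *)
Definition contour_perm_fun d := if desc d then contour d else d.

Lemma contour_perm_inj : injective contour_perm_fun.
Proof.
move=> x y; rewrite /contour_perm_fun; case: ifPn => dx; case: ifPn => dy //.
- exact: contour_inj.
- by move=> E; have [] := contourP dx; rewrite E (negPf dy).
- by move=> E; have [] := contourP dy; rewrite -E (negPf dx).
Qed.

Definition contour_perm := perm contour_perm_inj.

Lemma contour_permE d : desc d -> contour_perm d = contour d.
Proof. by move=> dd; rewrite permE /contour_perm_fun dd. Qed.

Lemma iter_contour_desc k d : desc d -> desc (iter k contour d).
Proof. by move=> dd; elim: k => //= k /contourP[]. Qed.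

Lemma iter_contour_permE k d : desc d -> iter k contour_perm d = iter k contour d.
Proof. by move=> dd; elim: k => //= k ->; rewrite contour_permE ?iter_contour_desc. Qed.

Lemma contour_reach d k : desc d -> iter k contour d \in porbit contour_perm d.
Proof. by move=> dd; rewrite -iter_contour_permE // porbit_iter. Qed.

(** From each corner the contour reaches, through ever lower corners, a dart
    pointing to z, and from there every dart pointing to z: it has one cycle. *)
Lemma contour_single x y : desc x -> desc y -> y \in porbit contour_perm x.
Proof.
have toz d : desc d -> exists2 b, b \in porbit contour_perm d & desc b && (e b \in porbit v z).
  have : L d <= L z + `|L d - L z|%N by have := lab_min lab d; lia.
  move: `|_|%N => N; elim: N d => [|N IH] d dN dd.
    by have := lab_min lab (e d); rewrite desc_level //; lia.
  case: (boolP (e d \in porbit v z)) => dz; first by exists d; rewrite ?porbit_id ?dd.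
  have [j [E _]] := lower_hitP dd dz; have [pd pd'] := prev_descP dz.
  have [|//|b bd bz] := IH (prev_desc (e d)).
    by rewrite (lab_orbit lab pd') desc_level //; lia.
  exists b => //; have := contour_reach j.+1 dd; rewrite E -eq_porbit_mem => /eqP <-.
  exact: bd.
have zz k a b : desc a -> e a \in porbit v z -> e b = iter k v (e a) -> b \in porbit contour_perm a.
  elim: k a => [|k IH] a da az; first by move/perm_inj ->; apply: porbit_id.
  have na : ~~ desc (phi a).
    apply/negP => h; suff /(desc_nz h) : e a \in porbit v (phi a) by rewrite az.
    by rewrite -eq_porbit_mem porbit_step.
  rewrite iterSr -/(phi a) -[phi a]eK => /IH.
  rewrite desc_e na eK => /(_ isT); rewrite -eq_porbit_mem porbit_step eq_porbit_mem => /(_ az).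
  have [j [E _]] := contour_next da na; have := contour_reach j.+1 da.
  by rewrite E -eq_porbit_mem => /eqP <-.
move=> dx dy; have [a xa /andP[da az]] := toz x dx; have [b yb /andP[db bz]] := toz y dy.
have : e b \in porbit v (e a) by move: az bz; rewrite -!eq_porbit_mem => /eqP -> /eqP ->.
case/iter_pback => k /(zz _ _ _ da az).
by move: xa yb; rewrite -!eq_porbit_mem => /eqP <- /eqP -> /eqP ->.
Qed.

End Contour.

(** * Labelled plane trees and the maps they encode *)

Lemma first_hit_trans (T : Type) (f : T -> T) (P R : pred T) x :
  (forall t, P t -> R t) -> (exists k, P (iter k.+1 f x)) ->
  ~~ P (first_hit f R x) -> first_hit f P x = first_hit f P (first_hit f R x).
Proof.
move=> PR [k hk]; have [j [_ Ej Pj hj]] := first_hitP hk.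
have [i [ij Ei Ri hi]] := first_hitP (PR _ Pj); rewrite Ei => nP.
have {}ij : (i < j)%N.
  by rewrite ltn_neqAle ij andbT; apply: contraNneq nP => ->.
have E a : iter a.+1 f (iter i.+1 f x) = iter (i + a.+1).+1 f x.
  by rewrite -iterD; congr (iter _ f x); lia.
have Eji : (i + (j - i.+1).+1).+1 = j.+1 by lia.
rewrite Ej; apply/esym; rewrite -Eji -E; apply: first_hitE; first by rewrite E Eji.
by move=> a aj; rewrite E; apply: hj; lia.
Qed.

Lemma first_hit_morph (T U : Type) (f : T -> T) (g : U -> U) (u : T -> U)
  (P : pred T) (R : pred U) x : (forall t, u (f t) = g (u t)) ->
  (forall t, R (u t) = P t) -> (exists k, P (iter k.+1 f x)) ->
  u (first_hit f P x) = first_hit g R (u x).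
Proof.
move=> uf RP [k hk]; have [j [_ -> Pj hj]] := first_hitP hk.
have E i : u (iter i f x) = iter i g (u x) by elim: i => //= i <-.
rewrite E; apply/esym/first_hitE => [|i ij]; first by rewrite -E RP.
by rewrite -E RP; apply: hj.
Qed.

Section LabelledTree.
Variable C : finType.

(** A plane tree with one element of C per corner: psi goes around the tree, al
    exchanges the two ends of each edge, and the orbits of al * psi are the
    vertices.  The corner psi c is at the vertex of al c, whence [lt_level]; the
    last condition is Euler's formula for one face. *)
Record labelled_tree (psi al : {perm C}) (l : C -> int) : Prop := LabelledTree {
  lt_al : forall c, al c != c /\ al (al c) = c;
  lt_single : forall x y, y \in porbit psi x;
  lt_level : forall c, l (psi c) = l (al c);
  lt_step : forall c, -1 <= l (al c) - l c <= 1;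
  lt_vertices : (#|porbits (al * psi)| * 2 = #|C| + 2)%N }.

Definition next_low (psi : {perm C}) (l : C -> int) (c : C) : C :=
  first_hit psi (fun x => l x <= l c) c.

Variables (psi al : {perm C}) (l : C -> int).
Hypothesis T : labelled_tree psi al l.
Local Notation nx := (next_low psi l).

Let alK c : al (al c) = c. Proof. by have [] := lt_al T c. Qed.

Lemma lt_psi_step c : -1 <= l (psi c) - l c <= 1.
Proof. by rewrite (lt_level T) (lt_step T). Qed.

Lemma lt_psi_al c : l (psi (al c)) = l c.
Proof. by rewrite (lt_level T) alK. Qed.

Lemma lt_reach x y : exists k, y = iter k.+1 psi x.
Proof. exact: iter_pback (lt_single T x y). Qed.

Lemma next_lowP c : exists j, [/\ nx c = iter j.+1 psi c, l (nx c) <= l c &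
  forall i, (i < j)%N -> l c < l (iter i.+1 psi c)].
Proof.
have [k E] := lt_reach c c.
have [|j [_ Ej Pj hj]] := @first_hitP _ psi (fun x => l x <= l c) k c; first by rewrite -E.
exists j; split=> // [|i ij]; first by rewrite /next_low Ej.
by rewrite ltNge; apply: hj.
Qed.

Lemma next_low_level c : l c <= l (psi c) -> l (nx c) = l c.
Proof.
move=> h; have [[|j] [E l1 h1]] := next_lowP c; move: l1; rewrite E => l1.
  by move: h l1 => /=; lia.
by have := h1 j (ltnSn _); have := lt_psi_step (iter j.+1 psi c); rewrite iterS in l1 *; lia.
Qed.

Lemma next_low_eq c : l (psi c) = l c -> nx c = psi c.
Proof. by move=> h; rewrite /next_low (@first_hitE _ _ _ 0) //= h. Qed.

(** A corner reached by a downward step closes an excursion: go back to the last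
    corner that was not above it. *)
Lemma next_low_onto c : l c < l (psi^-1%g c) ->
  exists2 y, l y < l (psi y) & nx y = c.
Proof.
move=> h.
have [k E] : exists k, c = iter k.+1 psi^-1%g c.
  by apply: iter_pback; rewrite porbit_id.
have [|j [_ _ Pj hj]] := @first_hitP _ psi^-1%g (fun x => l x <= l c) k c; first by rewrite -E.
case: j => [|j] in Pj hj; first by move: Pj => /=; lia.
set y := iter j.+2 _ _ in Pj.
have py i : (i <= j.+2)%N -> iter i psi y = iter (j.+2 - i) psi^-1%g c.
  elim: i => [|i IH] ij; first by rewrite subn0.
  rewrite iterS IH ?(ltnW ij) // (_ : j.+2 - i = (j.+2 - i.+1).+1)%N; last by lia.
  by rewrite iterS permKV.
have hj' i : (i < j.+1)%N -> l c < l (iter i.+1 psi^-1%g c) by move=> /hj; rewrite -ltNge.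
have ly : l y = l c.
  have := lt_psi_step y; have := hj' j (ltnSn j).
  by rewrite -[psi y]/(iter 1 psi y) py // subSS subn0; lia.
exists y.
  by rewrite -[psi y]/(iter 1 psi y) py // subSS subn0 ly; apply: hj'.
rewrite /next_low (@first_hitE _ _ _ j.+1).
- by rewrite py // subnn.
- by rewrite py // subnn /= ly.
- move=> i ij; rewrite py ?ly -?ltNge; last by lia.
  by rewrite (_ : j.+2 - i.+1 = (j - i).+1)%N; [apply: hj'; lia | lia].
Qed.

End LabelledTree.

(** The map drawn from a labelled tree by an edge from each corner c to the next
    corner of smaller label; u c is the dart leaving c along this edge.  Around
    the target of u c, the dart that follows the reverse of u c comes from the
    next corner of the level of c, unless the contour goes down at c.  Around
    the origin of a corner, the dart that follows is that of the next corner of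
    the vertex, unless a corner in between points there. *)
Record coded (D C : finType) (m : rmap D) (psi al : {perm C}) (l : C -> int)
    (u : C -> D) : Prop := Coded {
  cod_inj : injective u;
  cod_cover : forall d, exists c, d = u c \/ d = eperm m (u c);
  cod_disj : forall c c', eperm m (u c) != u c';
  cod_down : forall c, l (psi c) < l c -> vperm m (eperm m (u c)) = u (al c);
  cod_side : forall c, l c <= l (psi c) -> vperm m (u (psi c)) = u (al c);
  cod_next : forall c, l c <= l (psi c) ->
    vperm m (eperm m (u c)) = eperm m (u (next_low psi l c));
  cod_up : forall c, l c < l (psi c) ->
    vperm m (u (next_low psi l c)) = eperm m (u (psi c)) }.

Section CodedIsQuad.
Variables (D C : finType) (m : rmap D) (psi al : {perm C}) (l : C -> int) (u : C -> D).
Local Notation v := (vperm m).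
Local Notation e := (eperm m).
Local Notation nx := (next_low psi l).
Hypothesis eK : forall d, e d != d /\ e (e d) = d.
Hypothesis T : labelled_tree psi al l.
Hypothesis K : coded m psi al l u.

Let alK c : al (al c) = c. Proof. by have [] := lt_al T c. Qed.

(** The label of the origin of d; the edge of c ends one level below c. *)
Definition dart_level (d : D) : int :=
  if [pick c | u c == d] is Some c then l c
  else if [pick c | e (u c) == d] is Some c then l c - 1 else 0.

Lemma dart_level_u c : dart_level (u c) = l c.
Proof.
rewrite /dart_level; case: pickP => [x /eqP/(cod_inj K) -> //|/(_ c)].
by rewrite eqxx.
Qed.

Lemma dart_level_e c : dart_level (e (u c)) = l c - 1.
Proof.
rewrite /dart_level; case: pickP => [x /eqP h|_]; first by have := cod_disj K c x; rewrite h eqxx.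
case: pickP => [x /eqP/perm_inj/(cod_inj K) -> //|/(_ c)].
by rewrite eqxx.
Qed.

Local Notation Lam := dart_level.

Lemma desc_u c : desc m Lam (u c).
Proof. by rewrite /desc dart_level_e dart_level_u; lia. Qed.

Lemma desc_eu c : ~~ desc m Lam (e (u c)).
Proof. by rewrite /desc (eK _).2 dart_level_e dart_level_u; lia. Qed.

(** Corners of one level that are not separated by a lower corner point to the
    same corner, around which their edges follow each other. *)
Lemma level_chain j c : (forall i, (i <= j)%N -> l c <= l (iter i psi c)) ->
  l (iter j psi c) = l c ->
  exists k, e (u (iter j psi c)) = iter k v (e (u c)) /\
    forall i, (i <= k)%N -> ~~ desc m Lam (iter i v (e (u c))).
Proof.
have [N] := ubnP j; elim: N j c => // N IH j c jN hj lj.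
case: j => [|j] in jN hj lj *.
  by exists 0%N; split=> // -[|//] _; apply: desc_eu.
have h1 : l c <= l (psi c) := hj 1%N isT.
have [i [Ei _ hi]] := next_lowP T c; have ln := next_low_level T h1.
have ij : (i <= j)%N.
  by rewrite leqNgt; apply/negP => /hi; rewrite lj ltxx.
have E a : iter a psi (nx c) = iter (a + i.+1) psi c by rewrite Ei -iterD.
have [|||k [Ek hk]] := IH (j - i)%N (nx c).
- lia.
- by move=> a aj; rewrite ln E; apply: hj; lia.
- by rewrite E ln (_ : j - i + i.+1 = j.+1)%N //; lia.
rewrite E (_ : j - i + i.+1 = j.+1)%N in Ek; last lia.
exists k.+1; split; first by rewrite Ek -(cod_next K) // -iterSr.
move=> [_|a ak]; first exact: desc_eu.
by rewrite iterSr (cod_next K) //; apply: hk.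
Qed.

Lemma dart_level_v d : Lam (v d) = Lam d.
Proof.
have [c [->|->]] := cod_cover K d; last first.
  have [h|h] := ltP (l (psi c)) (l c).
    rewrite (cod_down K) // dart_level_u dart_level_e -(lt_level T).
    by have := lt_psi_step T c; lia.
  by rewrite (cod_next K) // !dart_level_e (next_low_level T).
have [h|h] := ltP (l c) (l (psi^-1%g c)).
  have [y hy <-] := next_low_onto T h.
  rewrite (cod_up K) // dart_level_u dart_level_e (next_low_level T (ltW hy)).
  by have := lt_psi_step T y; lia.
rewrite -[c](permKV psi) (cod_side K) ?permKV // !dart_level_u -(lt_level T).
by rewrite permKV.
Qed.

(** The edge of a corner that is not minimal ends at a lower corner. *)
Lemma lower_corner c x : l x < l c -> exists c',
  [/\ l c' < l c & u c' \in porbit v (e (u c))].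
Proof.
move=> xc; have [k Ek] := lt_reach T c x.
have [|j [_ Ej Pj hj]] := @first_hitP _ psi (fun y => l y < l c) k c; first by rewrite -Ek.
have hj' i : (i <= j)%N -> l c <= l (iter i psi c).
  by case: i => // i ij; have := hj i ij; rewrite -leNgt.
have lj : l (iter j psi c) = l c.
  by have := hj' j (leqnn j); have := lt_psi_step T (iter j psi c); move: Pj; rewrite iterS; lia.
have [k' [E' _]] := level_chain hj' lj.
exists (al (iter j psi c)); split; first by rewrite -(lt_level T).
by rewrite -(cod_down K) ?lj // E' -iterS porbit_iter.
Qed.

Lemma minimal_corners c c' : (forall x, l c <= l x) -> (forall x, l c' <= l x) ->
  e (u c') \in porbit v (e (u c)).
Proof.
move=> hc hc'; have [k Ek] := lt_reach T c c'.
have [||k' [+ _]] := @level_chain k.+1 c.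
- by move=> i _; apply: hc.
- by rewrite -Ek; have := hc c'; have := hc' c; lia.
by rewrite -Ek => ->; apply: porbit_iter.
Qed.

(** The labels of the tree are distances in the map: each corner points to a lower
    one, except that the minimal corners point to one additional vertex. *)
Lemma coded_labelling c0 : (forall x, l c0 <= l x) -> labelling m Lam (e (u c0)).
Proof.
move=> min0; split; first exact: dart_level_v.
  move=> d; have [c [->|->]] := cod_cover K d; rewrite ?(eK _).2 dart_level_e dart_level_u; lia.
move=> d; have [c [->|->]] := cod_cover K d => hd.
  by exists (u c); rewrite ?porbit_id //; apply: desc_u.
have [[x hx]|hc] := pselect (exists x, l x < l c).
  by have [c' [_ hc']] := lower_corner hx; exists (u c') => //; apply: desc_u.
case/negP: hd; apply: minimal_corners => // x; rewrite leNgt; apply/negP => h.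
by apply: hc; exists x.
Qed.

End CodedIsQuad.

Section CodedIsQuad.
Variables (D C : finType) (m : rmap D) (psi al : {perm C}) (l : C -> int) (u : C -> D).
Local Notation v := (vperm m).
Local Notation e := (eperm m).
Local Notation f := (e * v)%g.
Local Notation nx := (next_low psi l).
Hypothesis eK : forall d, e d != d /\ e (e d) = d.
Hypothesis T : labelled_tree psi al l.
Hypothesis K : coded m psi al l u.
Local Notation Lam := (dart_level m l u).
Local Notation phi := (face_next m).

Let alK c : al (al c) = c. Proof. by have [] := lt_al T c. Qed.
Let eKK d : e (e d) = d. Proof. by have [] := eK d. Qed.

Lemma card_coded : #|D| = (2 * #|C|)%N.
Proof.
pose h (x : C * bool) := if x.2 then u x.1 else e (u x.1).
have hI : injective h.
  move=> [c [|]] [c' [|]]; rewrite /h /=.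
  - by move/(cod_inj K) ->.
  - by move=> E; have := cod_disj K c' c; rewrite E eqxx.
  - by move=> E; have := cod_disj K c c'; rewrite E eqxx.
  - by move/perm_inj/(cod_inj K) ->.
have : #|[set h x | x in [set: C * bool]]| = #|[set: D]|.
  congr #|pred_of_set _|; apply/setP => d; rewrite inE; apply/imsetP.
  by have [c [->|->]] := cod_cover K d; [exists (c, true)|exists (c, false)].
by rewrite card_imset // !cardsT card_prod card_bool mulnC.
Qed.

Lemma phi_down c : l (psi c) < l c -> phi (u c) = u (al c).
Proof. exact: (cod_down K). Qed.

Lemma phi_next c : l c <= l (psi c) -> phi (u c) = e (u (nx c)).
Proof. exact: (cod_next K). Qed.

Lemma phi_side c : l c <= l (psi c) -> phi (e (u (psi c))) = u (al c).
Proof. by move=> h; rewrite /face_next eKK (cod_side K). Qed.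

Lemma phi_up c : l c < l (psi c) -> phi (e (u (nx c))) = e (u (psi c)).
Proof. by move=> h; rewrite /face_next eKK (cod_up K). Qed.

Lemma al_down c : (l (psi (al c)) < l (al c)) = (l c < l (psi c)).
Proof. by rewrite (lt_psi_al T) (lt_level T). Qed.

(** Each face is the quadrangle surrounding one edge of the tree: it passes by the
    two ends c and al c of this edge. *)
Lemma face_corner c : [/\ phi (phi (phi (phi (u c)))) = u c & phi (phi (u c)) != u c].
Proof.
have [h|h|h] := ltgtP (l (psi c)) (l c).
- have h' : l (al c) < l (psi (al c)) by rewrite (lt_psi_al T) -(lt_level T).
  rewrite phi_down // (phi_next (ltW h')) phi_up // phi_side ?(ltW h') // alK.
  by split=> //; exact: (cod_disj K).
- have h' : l (psi (al c)) < l (al c) by rewrite al_down.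
  rewrite (phi_next (ltW h)) phi_up // phi_side ?(ltW h) // phi_down // alK.
  by split=> //; exact: (cod_disj K).
- have h' : l (psi (al c)) = l (al c) by rewrite (lt_psi_al T) -(lt_level T).
  rewrite phi_next ?h // next_low_eq // phi_side ?h // phi_next ?h' // next_low_eq //.
  rewrite phi_side ?h' // alK; split=> //.
  by apply/eqP => /(cod_inj K)/eqP; have [/negPf ->] := lt_al T c.
Qed.

Lemma face_dart d : exists c i, d = iter i phi (u c).
Proof.
have [c [->|->]] := cod_cover K d; first by exists c, 0%N.
have [h|h|h] := ltgtP (l (psi^-1%g c)) (l c).
- exists (psi^-1%g c), 2%N; rewrite /= phi_next ?permKV ?(ltW h) // phi_up ?permKV //.
- by have [y hy <-] := next_low_onto T h; exists y, 1%N; rewrite /= phi_next // ltW.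
- exists (psi^-1%g c), 1%N; rewrite /= phi_next ?permKV ?h //.
  by rewrite next_low_eq ?permKV.
Qed.

Lemma card_face d : #|porbit f d| = 4.
Proof.
have fE x : f x = phi x by rewrite permM.
have [c [i ->]] := face_dart d; have [h4 h2] := face_corner c.
have := porbit_iter f i (u c); rewrite (eq_iter fE) -eq_porbit_mem => /eqP ->.
by apply: card_porbit4; rewrite !fE.
Qed.

Let reach_in (A : {set D}) c : (forall d, (v d \in A) = (d \in A)) -> (forall d, (e d \in A) = (d \in A)) ->
  (u c \in A) -> exists2 c0, (forall x, l c0 <= l x) & u c0 \in A.
Proof.
move=> Av Ae uA.
pose P c' := u c' \in A; have Pc : P c by [].
have [c0 Pc0 min0] := @arg_minP _ int C c P l Pc.
exists c0 => // x; rewrite leNgt; apply/negP => h.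
have [c' [lc' hc']] := lower_corner eK T K h.
have := min0 c'; rewrite /P (porbit_inv (F := fun d => d \in A) Av hc') Ae => /(_ Pc0); lia.
Qed.

Lemma coded_connected (c1 : C) : connected_map m.
Proof.
have [c0 _ min0] := @arg_minP _ int C c1 predT l isT.
have {}min0 x : l c0 <= l x by apply: min0.
apply: (@inv_connected _ _ (u c0)) => A zA Av Ae; apply/setP => d; rewrite inE.
have in0 (B : {set D}) c : (forall d, (v d \in B) = (d \in B)) -> (forall d, (e d \in B) = (d \in B)) ->
    u c \in B -> u c0 \in B.
  move=> Bv Be /(reach_in Bv Be)[c' minc' c'B].
  by have := minimal_corners eK T K minc' min0 => /(porbit_inv (F := fun d => d \in B) Bv); rewrite !Be => ->.
(* A and its complement, if both nonempty, would both contain a minimal corner. *)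
apply: contraT => dA.
have : u c0 \in ~: A.
  have Bv x : (v x \in ~: A) = (x \in ~: A) by rewrite !inE Av.
  have Be x : (e x \in ~: A) = (x \in ~: A) by rewrite !inE Ae.
  have [c [E|E]] := cod_cover K d; apply: (in0 _ c) => //; first by rewrite -E inE.
  by rewrite -Be -E inE.
by rewrite inE zA.
Qed.

(** A dart is sent to the tree vertex of its origin, or to None if it leaves the
    additional vertex; no turn around a vertex changes this value. *)
Lemma coded_vertices (c1 : C) : (#|porbits (al * psi)| + 1 <= #|vertices m|)%N.
Proof.
have [cm _ minm] := @arg_minP _ int C c1 predT l isT.
pose low c := first_hit psi (fun x => l x < l c) c.
pose N (d : D) : option {set C} :=
  if [pick c | u c == d] is Some c then Some (porbit (al * psi) c)
  else if [pick c | e (u c) == d] is Some c then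
    if [exists x, l x < l c] then Some (porbit (al * psi) (low c)) else None
  else None.
have Nu c : N (u c) = Some (porbit (al * psi) c).
  rewrite /N; case: pickP => [x /eqP/(cod_inj K) -> //|/(_ c)].
  by rewrite eqxx.
have Ne c : N (e (u c)) = if [exists x, l x < l c] then Some (porbit (al * psi) (low c)) else None.
  rewrite /N; case: pickP => [x /eqP h|_]; first by have := cod_disj K c x; rewrite h eqxx.
  case: pickP => [x /eqP/perm_inj/(cod_inj K) -> //|/(_ c)].
  by rewrite eqxx.
have alpsi c : porbit (al * psi) (al c) = porbit (al * psi) (psi c).
  by have := porbit_step (al * psi) (al c); rewrite permM alK => <-.
have Nv d : N (v d) = N d.
  have [c [->|->]] := cod_cover K d; last first.
    have [h|h] := ltP (l (psi c)) (l c).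
      rewrite (cod_down K) // Nu Ne (_ : [exists x, l x < l c]); last by apply/existsP; exists (psi c).
      by rewrite /low (@first_hitE _ _ _ 0) //= alpsi.
    rewrite (cod_next K) // !Ne (next_low_level T h); case: ifP => // /existsP[x hx].
    congr (Some (porbit _ _)); rewrite /low (next_low_level T h); apply/esym.
    apply: first_hit_trans => [t /ltW //||].
      by have [k Ek] := lt_reach T c x; exists k; rewrite -Ek.
    by rewrite -[first_hit _ _ _]/(nx c) (next_low_level T h) ltxx.
  have [h|h] := ltP (l c) (l (psi^-1%g c)).
    have [y hy <-] := next_low_onto T h.
    rewrite (cod_up K) // Ne Nu (_ : [exists x, l x < l (psi y)]); last by apply/existsP; exists y.
    congr (Some (porbit _ _)); rewrite /low.
    have E : l (psi y) = l y + 1 by have := lt_psi_step T y; lia.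
    have -> : nx y = first_hit psi (fun x => l x <= l y) (psi y).
      apply: first_hit_step; first by rewrite -ltNge.
      by have [k Ek] := lt_reach T y y; exists k; rewrite -Ek.
    by congr first_hit; apply/funext => x; rewrite E; lia.
  rewrite -[c](permKV psi) (cod_side K) ?permKV // !Nu.
  by rewrite alpsi permKV.
have := @card_porbits_ge D _ v N (None |: [set Some X | X in porbits (al * psi)]) Nv.
rewrite cardsU1 card_imset; last by move=> x y [].
rewrite (_ : None \notin _) ?add1n ?addn1; last by apply/imsetP => -[].
apply=> a /setU1P[->|/imsetP[X /imsetP[c _ ->] ->]]; last by exists (u c).
exists (e (u cm)); rewrite Ne; case: ifP => // /existsP[x].
by rewrite ltNge minm.
Qed.

(** With the faces and the edges counted, [coded_vertices] is one half of Euler's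
    formula and [euler_le] the other. *)
Lemma coded_quad (c1 : C) : quadrangulation m /\ (#|faces m| * 2)%N = #|C|.
Proof.
have cD := card_coded; have cE := card_edges eK.
have cF : (#|faces m| * 4)%N = #|D| by apply: card_porbits_uniform; exact: card_face.
have cV := coded_vertices c1; have cT := lt_vertices T.
have conn := coded_connected c1.
have eul := euler_le rat eK conn (u c1).
split; last by lia.
apply/andP; split; last by apply/forallP => X; apply/implyP => /imsetP[d _ ->]; rewrite card_face.
apply/and3P; split=> //; last by lia.
by apply/forallP => d; have [-> ->] := eK d; rewrite eqxx.
Qed.

Lemma coded_mate c : mate m Lam (u c) = u (al c).
Proof.
have du := desc_u K; have de := desc_eu eK K.
rewrite /mate; have [h|h|h] := ltgtP (l (psi c)) (l c).
- by rewrite phi_down // du.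
- by rewrite (phi_next (ltW h)) (negPf (de _)) phi_up // (negPf (de _)) phi_side // ltW.
- by rewrite phi_next ?h // next_low_eq // (negPf (de _)) phi_side ?h // du.
Qed.

(** At a downward step the edges met, when turning back from c to the corner psi c,
    come from the corners of the excursion that psi c closes ([level_chain]). *)
Lemma coded_contour c : contour m Lam (u c) = u (psi c).
Proof.
have du := desc_u K; have de := desc_eu eK K.
rewrite /contour coded_mate; have [h|h] := ltP (l (psi c)) (l c); last first.
  have E : v^-1%g (u (al c)) = u (psi c) by rewrite -(cod_side K) // permK.
  by rewrite prev_desc_here E.
have [|y hy ny] := @next_low_onto _ _ _ _ T (psi c); first by rewrite permK.
have ly : l (psi c) = l y by rewrite -ny (next_low_level T (ltW hy)).
have [[|j] [Ej _ hj]] := next_lowP T y.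
  by move: hy; rewrite -[psi y]/(iter 1 psi y) -Ej ny; lia.
have Ec : c = iter j psi (psi y).
  by apply: (@perm_inj _ psi); rewrite -ny Ej -iterSr.
have l1 : l (psi y) = l y + 1 by have := lt_psi_step T y; lia.
have lc : l c = l y + 1 by have := lt_psi_step T c; lia.
have [||k [Ek hk]] := @level_chain _ _ _ _ _ _ _ eK T K j (psi y).
- by move=> i ij; rewrite l1 -iterSr; have := hj i; rewrite ltnS => /(_ ij); lia.
- by rewrite -Ec; lia.
rewrite -Ec in Ek.
have back i : (i <= k)%N -> iter i.+1 v^-1%g (u (al c)) = iter (k - i) v (e (u (psi y))).
  rewrite -(cod_down K) // Ek => ik; rewrite iterSr permK.
  by rewrite -{1}(subnK ik) addnC iterD iter_pinv.
have E : iter k.+2 v^-1%g (u (al c)) = u (psi c).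
  by rewrite iterS back // subnn /= -(cod_up K) // ny permK.
rewrite /prev_desc -E; apply: first_hitE; first by rewrite E.
by move=> i ik; rewrite back //; apply: hk; apply: leq_subr.
Qed.

End CodedIsQuad.

(** * Maps with the same code, and maps with a given code *)

Lemma quad_counts (D : finType) (m : rmap D) : quadrangulation m ->
  [/\ (#|faces m| * 4 = #|D|)%N, (#|edges m| * 2 = #|D|)%N
    & (#|vertices m| + #|faces m| = #|edges m| + 2)%N].
Proof.
move=> Q; split.
- by apply: card_porbits_uniform; exact: quad_card4.
- exact/card_edges/planar_eK/quad_planar.
- by case/andP: Q => /and3P[_ _ /eqP].
Qed.

Lemma tree_vertices_le (C : finType) (psi al : {perm C}) (c0 : C) :
  (forall c, al c != c /\ al (al c) = c) -> (forall x y, y \in porbit psi x) ->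
  (#|porbits (al * psi)| * 2 <= #|C| + 2)%N.
Proof.
move=> aK single; pose t := RMap (al * psi)%g al c0.
have conn : connected_map t.
  apply: (@inv_connected _ _ c0) => A cA Av Aa; apply/setP => x; rewrite inE.
  suff Ap d : (psi d \in A) = (d \in A).
    by rewrite (porbit_inv (F := fun d => d \in A) Ap (single c0 x)).
  by have := Av (al d); rewrite /= permM (aK d).2 => ->; rewrite -[al d]/(eperm t d) Aa.
have E := card_edges (m := t) aK; have eul := euler_le rat (m := t) aK conn c0.
have fE : faces t = porbits psi.
  by rewrite /faces /=; congr porbits; apply/permP => x; rewrite !permM (aK x).2.
have : (0 < #|faces t|)%N.
  by rewrite fE; apply/card_gt0P; exists (porbit psi c0); apply: imset_f.
have key a b c d : (b * 2 = c -> a + d <= b + 2 -> 0 < d -> a * 2 <= c + 2)%N by lia.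
by move=> f0; apply: (key _ _ _ _ E eul f0).
Qed.

(** The conditions of [coded] determine the dart following each dart: a corner
    whose dart is not followed as in [cod_side] closes an excursion, to which
    [cod_up] applies. *)
Lemma coded_iso (D C : finType) (m m' : rmap D) (psi al : {perm C}) l (u u' : C -> D) :
  (forall d, eperm m d != d /\ eperm m (eperm m d) = d) ->
  (forall d, eperm m' d != d /\ eperm m' (eperm m' d) = d) ->
  labelled_tree psi al l -> coded m psi al l u -> coded m' psi al l u' ->
  exists g : {perm D}, [/\ forall d, g (vperm m d) = vperm m' (g d),
    forall d, g (eperm m d) = eperm m' (g d) & forall c, g (u c) = u' c].
Proof.
move=> eK eK' T K K'.
pose g0 d := if [pick c | u c == d] is Some c then u' c
  else if [pick c | eperm m (u c) == d] is Some c then eperm m' (u' c) else d.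
have gu c : g0 (u c) = u' c.
  rewrite /g0; case: pickP => [x /eqP/(cod_inj K) -> //|/(_ c)].
  by rewrite eqxx.
have ge c : g0 (eperm m (u c)) = eperm m' (u' c).
  rewrite /g0; case: pickP => [x /eqP h|_]; first by have := cod_disj K c x; rewrite h eqxx.
  case: pickP => [x /eqP/perm_inj/(cod_inj K) -> //|/(_ c)].
  by rewrite eqxx.
have gI : injective g0.
  move=> x y; have [c [->|->]] := cod_cover K x; have [c' [->|->]] := cod_cover K y;
    rewrite ?gu ?ge.
  - by move/(cod_inj K') ->.
  - by move=> E; have := cod_disj K' c' c; rewrite E eqxx.
  - by move=> E; have := cod_disj K' c c'; rewrite E eqxx.
  - by move/perm_inj/(cod_inj K') ->.
exists (perm gI); split=> [d|d|c]; rewrite !permE ?gu //; last first.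
  by have [c [->|->]] := cod_cover K d; rewrite ?(eK _).2 ?gu ?ge ?(eK' _).2 ?gu.
have [c [->|->]] := cod_cover K d; last first.
  have [h|h] := ltP (l (psi c)) (l c).
    by rewrite (cod_down K) // ge (cod_down K') // gu.
  by rewrite (cod_next K) // !ge (cod_next K').
have [h|h] := ltP (l c) (l (psi^-1%g c)).
  have [y hy <-] := next_low_onto T h.
  by rewrite (cod_up K) // ge gu (cod_up K').
have := cod_side K (c := psi^-1%g c); have := cod_side K' (c := psi^-1%g c).
by rewrite permKV gu => /(_ h) -> /(_ h) ->; rewrite gu.
Qed.

Lemma next_low_inj (C : finType) (psi al : {perm C}) l : labelled_tree psi al l ->
  {in [pred c | l c < l (psi c)] &, injective (next_low psi l)}.
Proof.
move=> T y y'; rewrite !inE => hy hy' E.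
have ly := next_low_level T (ltW hy); have ly' := next_low_level T (ltW hy').
have [j [Ej _ hj]] := next_lowP T y; have [j' [Ej' _ hj']] := next_lowP T y'.
wlog jj : y y' j j' hy hy' E ly ly' Ej Ej' hj hj' / (j <= j')%N.
  move=> W; case: (leqP j j') => jj; first exact: (W y y' j j').
  by apply/esym/(W y' y j' j) => //; apply: ltnW.
move: (E); rewrite Ej Ej' (_ : j'.+1 = (j.+1 + (j' - j))%N); last by lia.
rewrite iterD -!permX => /perm_inj; rewrite permX.
case Ek: (j' - j)%N => [//|k] Ey; have := hj' k; rewrite -Ey -ly -ly' E.
have kj : (k < j')%N by lia.
by rewrite ltxx kj => /(_ isT).
Qed.

(** The rotation is built from the faces: the map sending a dart to the next one of
    its face is onto, hence bijective on a finite set. *)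
Lemma coded_exists (D C : finType) (psi al : {perm C}) l (c0 : C) (b : bool) :
  labelled_tree psi al l -> #|D| = (2 * #|C|)%N ->
  exists (m : rmap D) (u : C -> D),
    [/\ forall d, eperm m d != d /\ eperm m (eperm m d) = d,
        coded m psi al l u & rootd m = if b then u c0 else eperm m (u c0)].
Proof.
move=> T cD.
have alK c : al (al c) = c by have [] := lt_al T c.
have cE : #|{: C * bool}| = #|D| by rewrite cD card_prod card_bool mulnC.
pose h (x : C * bool) : D := enum_val (cast_ord cE (enum_rank x)).
pose h' (d : D) : C * bool := enum_val (cast_ord (esym cE) (enum_rank d)).
have hK : cancel h h' by move=> x; rewrite /h /h' enum_valK cast_ordK enum_rankK.
have hK' : cancel h' h by move=> x; rewrite /h /h' enum_valK cast_ordKV enum_rankK.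
pose flip (x : C * bool) := (x.1, ~~ x.2).
have flipK : involutive flip by move=> [c []].
pose back c := odflt c [pick y | (l y < l (psi y)) && (next_low psi l y == c)].
have backE y : l y < l (psi y) -> back (next_low psi l y) = y.
  move=> hy; rewrite /back; case: pickP => [x /andP[hx /eqP]|/(_ y)]; last by rewrite hy eqxx.
  by move/(next_low_inj T); rewrite !inE; apply.
pose F (x : C * bool) := let: (c, d) := x in
  if d then if l (psi c) < l c then (al c, true) else (next_low psi l c, false)
  else if l (psi^-1%g c) <= l c then (al (psi^-1%g c), true) else (psi (back c), false).
have FS x : exists y, F y = x.
  case: x => c [].
    have [h1|h1] := ltP (l (psi (al c))) (l (al c)).
      by exists (al c, true); rewrite /F h1 alK.
    by exists (psi (al c), false); rewrite /F permK h1 alK.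
  have [h1|h1] := ltP (l c) (l (psi^-1%g c)).
    have [y hy E] := next_low_onto T h1; exists (y, true).
    by rewrite /F ltNge (ltW hy) E.
  have [h2|h2] := ltP (l (psi^-1%g c)) (l c).
    set x := psi^-1%g c in h1 h2; have Ex : psi x = c by rewrite permKV.
    have hx : l x < l (psi x) by rewrite Ex.
    exists (next_low psi l x, false); rewrite /F.
    have lv := next_low_level T (ltW hx).
    rewrite leNgt (_ : _ < _ = true) ?backE ?Ex //.
    have [[|j] [Ej _ hj]] := next_lowP T x.
      by move: lv hx; rewrite Ej /=; lia.
    by rewrite Ej iterS permK -iterS -Ej lv; apply: hj.
  exists (psi^-1%g c, true); rewrite /F permKV.
  have E : l c = l (psi^-1%g c) by lia.
  by rewrite E ltxx next_low_eq permKV.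
have FI : injective F.
  have /image_injP FI' : #|[seq F x | x in {: C * bool}]| == #|{: C * bool}|.
    by apply/eqP/eq_card => x; have [y <-] := FS x; rewrite fintype.image_f.
  by move=> x y; apply: FI'.
have eI : injective (h \o flip \o h').
  exact: inj_comp (inj_comp (can_inj hK) (can_inj flipK)) (can_inj hK').
have vI : injective (h \o F \o flip \o h').
  apply: inj_comp (can_inj hK'); apply: inj_comp (can_inj flipK).
  exact: inj_comp (can_inj hK) FI.
pose u c := h (c, true).
pose m0 r := RMap (perm vI) (perm eI) r.
have eu c r : eperm (m0 r) (u c) = h (c, false) by rewrite permE /= /u hK.
have vt c r : vperm (m0 r) (u c) = h (F (c, false)) by rewrite permE /= /u hK.
have vf c r : vperm (m0 r) (h (c, false)) = h (F (c, true)) by rewrite permE /= hK.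
have cod r : coded (m0 r) psi al l u.
  split.
  - by move=> x y /(can_inj hK)[].
  - move=> d; rewrite -[d]hK'; case: (h' d) => c []; exists c; [by left|right].
    by rewrite eu.
  - by move=> c c'; rewrite eu; apply/eqP => /(can_inj hK).
  - by move=> c hc; rewrite eu vf /F hc.
  - by move=> c hc; rewrite vt /F permK hc.
  - by move=> c hc; rewrite !eu vf /F ltNge hc.
  - move=> c hc; rewrite eu vt /F backE // leNgt (_ : _ < _ = true) //.
    have lv := next_low_level T (ltW hc).
    have [[|j] [Ej _ hj]] := next_lowP T c.
      by move: lv hc; rewrite Ej /=; lia.
    by rewrite Ej iterS permK -iterS -Ej lv; apply: hj.
exists (m0 (if b then u c0 else h (c0, false))), u; split=> //.
  move=> d; rewrite !permE /= hK flipK hK'; split=> //.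
  apply/eqP => /(congr1 h'); rewrite hK; case: (h' d) => c [] //.
by case: b => //; rewrite eu.
Qed.

(** * The code of a labelled quadrangulation *)

(** The contour of a tree whose corners are numbered along it. *)
Definition turn N : {perm 'I_N} := perm (@ordS_inj N).

Lemma iter_turn N k (c : 'I_N) : val (iter k (turn N) c) = ((c + k) %% N)%N.
Proof.
elim: k => [|k IH]; first by rewrite addn0 modn_small.
by rewrite iterS permE /= IH addnS -addn1 modnDml addn1.
Qed.

Lemma turn_single N (x y : 'I_N) : y \in porbit (turn N) x.
Proof.
have -> : y = iter (N - x + y) (turn N) x; last exact: porbit_iter.
apply: val_inj; rewrite iter_turn addnA subnKC; last exact: ltnW.
by rewrite modnDl modn_small.
Qed.

Section LabellingCoded.
Variables (D : finType) (m : rmap D) (L : D -> int) (z r : D) (n : nat).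
Hypothesis Q : quadrangulation m.
Hypothesis lab : labelling m L z.
Hypothesis cD : #|D| = (4 * n)%N.
Hypothesis dr : desc m L r.
Local Notation v := (vperm m).
Local Notation e := (eperm m).
Local Notation N := (2 * n)%N.
Local Notation psiD := (contour m L).

(** The descending darts, in the order of the contour starting from r. *)
Definition contour_dart (k : 'I_N) : D := iter k psiD r.
Local Notation u := contour_dart.

Let eK := planar_eK (quad_planar Q).

Lemma card_desc : #|[set d | desc m L d]| = N.
Proof.
have E : ~: [set d | desc m L d] = e @: [set d | desc m L d].
  apply/setP => d; rewrite !inE; apply/idP/imsetP => [h|[x]].
    by exists (e d); rewrite ?inE ?(desc_e Q lab) ?(eK _).2.
  by rewrite inE => h ->; rewrite (desc_e Q lab) negbK.
have := cardsC [set d | desc m L d]; rewrite E card_imset; last exact: perm_inj.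
by rewrite cD; lia.
Qed.

Lemma desc_contour_dart k : desc m L (u k).
Proof. exact: (iter_contour_desc Q lab). Qed.

Let cp := contour_perm Q lab.

Lemma porbit_desc : porbit cp r = [set d | desc m L d].
Proof.
apply/setP => d; rewrite inE; apply/idP/idP; last exact: contour_single.
by case/porbitP => i ->; rewrite permX iter_contour_permE // (iter_contour_desc Q lab).
Qed.

Let card_orbit : #|porbit cp r| = N. Proof. by rewrite porbit_desc card_desc. Qed.

Lemma contour_dart_inj : injective u.
Proof.
move=> i j; rewrite /u -!(iter_contour_permE Q lab) // => E.
have := uniq_traject_porbit cp r; rewrite card_orbit => U.
apply/val_inj/eqP; rewrite -(nth_uniq r _ _ U) ?size_traject ?ltn_ord //.
by rewrite !nth_traject ?ltn_ord //; apply/eqP.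
Qed.

Lemma contour_dart_onto d : desc m L d -> exists k, d = u k.
Proof.
move=> dd; have : d \in porbit cp r by rewrite porbit_desc inE.
rewrite porbit_traject card_orbit => /trajectP[i iN ->].
by exists (Ordinal iN); rewrite /u iter_contour_permE.
Qed.

Lemma contour_dart_turn k : u (turn N k) = psiD (u k).
Proof.
rewrite /u -iterS permE /=; have := ltn_ord k; rewrite leq_eqVlt => /orP[/eqP E|h].
  rewrite E modnn -[LHS]/r.
  have H := iter_porbit cp r; rewrite card_orbit iter_contour_permE // in H.
  by rewrite -{1}H -iterS; congr (iter _ psiD r); apply/esym.
by rewrite modn_small.
Qed.

Let mk k := odflt k [pick k' | u k' == mate m L (u k)].

Let mkE k : u (mk k) = mate m L (u k).
Proof.
have [k' E] := contour_dart_onto (desc_mate Q lab (desc_contour_dart k)).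
by rewrite /mk; case: pickP => [x /eqP //|/(_ k')]; rewrite E eqxx.
Qed.

Let mkK : involutive mk.
Proof. by move=> k; apply: contour_dart_inj; rewrite !mkE (mateK Q lab) // desc_contour_dart. Qed.

(** The tree has at least n + 1 vertices, those of the map other than z, and by
    [tree_vertices_le] no more. *)
Lemma labelling_coded : exists al : {perm 'I_N},
  labelled_tree (turn N) al (L \o u) /\ coded m (turn N) al (L \o u) u.
Proof.
pose al := perm (inv_inj mkK).
have alE k : u (al k) = mate m L (u k) by rewrite permE mkE.
have alK k : al k != k /\ al (al k) = k.
  rewrite !permE mkK; split=> //; apply/eqP => E.
  by have := mate_neq L Q (u k); rewrite -mkE E eqxx.
have du := desc_contour_dart.
have lv k : (L \o u) (turn N k) = (L \o u) (al k).
  by rewrite /= contour_dart_turn alE; have [] := contourP Q lab (du k).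
have stepP k : -1 <= (L \o u) (al k) - (L \o u) k <= 1.
  by rewrite /= alE; case: (mateP Q lab (du k)) => *; lia.
exists al; split.
  split=> //; first exact: turn_single.
  have [cF cE cV] := quad_counts Q.
  have [k0 _] := contour_dart_onto dr.
  apply/eqP; rewrite eqn_leq (tree_vertices_le k0) //=; last exact: turn_single.
  have := @card_porbits_ge _ _ (al * turn N)%g (fun k => porbit v (u k)) (vertices m :\ porbit v z).
  rewrite card_ord => W; suff : (#|vertices m :\ porbit v z| <= #|porbits (al * turn N)|)%N.
    have cVm : #|vertices m| = n.+2 by move: cF cE cV; rewrite cD; lia.
    have := cardsD1 (porbit v z) (vertices m); rewrite imset_f // cVm => -[]; rewrite add0n => <-.
    by move: #|porbits _| => p; lia.
  apply: W => [k|X /setD1P[nX /imsetP[d _ E]]].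
    rewrite permM contour_dart_turn /contour alE (mateK Q lab) ?du //.
    apply/eqP; rewrite eq_porbit_mem.
    have [//|_ h] := prev_descP lab (d := u k); last by [].
    by apply: (desc_nz Q lab (du k)); rewrite porbit_id.
  have [|d' dd' h] := @lab_desc _ _ _ _ lab d.
    by rewrite -eq_porbit_mem -E.
  have [k Ek] := contour_dart_onto h; exists k; rewrite -Ek E; apply/eqP.
  by rewrite eq_porbit_mem.
have fh k : (L \o u) k <= (L \o u) (turn N k) -> ~~ desc m L (face_next m (u k)).
  by rewrite lv /= alE => h; case: (mateP Q lab (du k)) => //; lia.
have nxE k : (L \o u) k <= (L \o u) (turn N k) ->
    u (next_low (turn N) (L \o u) k) = e (face_next m (u k)).
  move=> h; rewrite -(first_hit_side Q lab (du k) (fh k h)) /next_low.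
  apply: first_hit_morph => //; first exact: contour_dart_turn.
  have [i E] := iter_pback (turn_single k k); exists i; by rewrite -E.
split.
- exact: contour_dart_inj.
- move=> d; have [/contour_dart_onto[k ->]|h] := boolP (desc m L d); first by exists k; left.
  have [|k Ek] := @contour_dart_onto (e d); first by rewrite (desc_e Q lab).
  by exists k; right; rewrite -Ek (eK d).2.
- by move=> k k'; apply: contraTneq (du k') => <-; rewrite (desc_e Q lab) du.
- move=> k; rewrite lv /= alE; case: (mateP Q lab (du k)) => [_ -> //|_ _ _ ->|_ _ _ ->]; lia.
- move=> k h; have := fh k h; rewrite contour_dart_turn alE => h1.
  case: (boolP (desc m L (face_next m (face_next m (u k))))) => h2.
    rewrite (contour_side Q lab) ?du //; case: (mateP Q lab (du k)) => [|_ _ -> //|_]; last by rewrite h2.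
    by rewrite (negPf h1).
  rewrite (contour_up Q lab) ?du //; case: (mateP Q lab (du k)) => [|_|_ _ -> //].
    by rewrite (negPf h1).
  by rewrite (negPf h2).
- by move=> k h; rewrite nxE // (eK _).2.
- move=> k h; rewrite nxE; last exact: ltW.
  have h1 := fh k (ltW h); rewrite contour_dart_turn.
  case: (boolP (desc m L (face_next m (face_next m (u k))))) => h2.
    move: h; rewrite lv /= alE; case: (mateP Q lab (du k)) => [|_ _ _ ->|_]; rewrite ?(negPf h1) ?h2 //.
    by lia.
  by rewrite (contour_up Q lab) ?du // (eK _).2.
Qed.

End LabellingCoded.

(** The minimal corners give the origin of the labelling, hence the labelling, hence
    the contour; the starting corner does the rest. *)
Lemma coded_unique (D : finType) (m : rmap D) N (al al' : {perm 'I_N}) l l'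
    (u u' : 'I_N -> D) (k0 c c' : 'I_N) :
  planar_map m -> labelled_tree (turn N) al l -> labelled_tree (turn N) al' l' ->
  coded m (turn N) al l u -> coded m (turn N) al' l' u' -> u k0 = u' k0 ->
  (forall x, l c <= l x) -> (forall x, l' c' <= l' x) ->
  eperm m (u c) = eperm m (u' c') -> al = al' /\ forall k, l k - l k0 = l' k - l' k0.
Proof.
move=> P T T' K K' u0 minc minc' E; have eK := planar_eK P.
have lab := coded_labelling eK T K minc; have lab' := coded_labelling eK T' K' minc'.
set Lam := dart_level m l u in lab; set Lam' := dart_level m l' u' in lab'.
have dif d : Lam d - Lam (eperm m (u c)) = Lam' d - Lam' (eperm m (u' c')).
  have a := labelling_le P lab lab'; have b := labelling_le P lab' lab.
  by apply: le_anti; rewrite -E in a b *; rewrite a ?b ?porbit_id.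
have dE : desc m Lam = desc m Lam'.
  by apply/funext => d; rewrite /desc; have := dif d; have := dif (eperm m d); lia.
have mE : mate m Lam = mate m Lam' by rewrite /mate dE.
have cE : contour m Lam = contour m Lam' by rewrite /contour /prev_desc mE dE.
have uE k : u k = u' k.
  have [i ->] := iter_pback (turn_single k0 k); elim: i.+1 => //= j IH.
  by rewrite -(coded_contour eK T K) -(coded_contour eK T' K') -/Lam -/Lam' cE IH.
split.
  apply/permP => k; apply: (cod_inj K'); rewrite -uE -(coded_mate eK K) -(coded_mate eK K').
  by rewrite -/Lam -/Lam' mE uE.
move=> k; have := dif (u k); have := dif (u k0).
rewrite /Lam /Lam' (dart_level_u K k) (dart_level_u K k0) (uE k) (uE k0).
by rewrite (dart_level_u K' k) (dart_level_u K' k0); lia.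
Qed.

(** * Labels of a plane tree as sums of increments *)

Section Codes.
Variable n : nat.
Local Notation N := (2 * n)%N.

(** The involutions that match the 2n corners as the ends of the edges of a plane
    tree: those with n + 1 vertices. *)
Definition plane_tree (al : {perm 'I_N}) : bool :=
  [forall c, (al c != c) && (al (al c) == c)] &&
  (#|porbits (al * turn N)| * 2 == N + 2)%N.

(** The increment 0, when -1, 0, 1 are encoded by 0, 1, 2. *)
Definition flat : 'I_3 := @Ordinal 3 1 isT.

(** One increment per edge, carried by the first of its two corners. *)
Definition tree_incr (al : {perm 'I_N}) : pred {ffun 'I_N -> 'I_3} :=
  pffun_on flat [pred c : 'I_N | (c < al c)%N] predT.

Definition incr (al : {perm 'I_N}) (x : {ffun 'I_N -> 'I_3}) (c : 'I_N) : int :=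
  if (c < al c)%N then (x c)%:Z - 1 else 1 - (x (al c))%:Z.

Definition tree_label (al : {perm 'I_N}) (x : {ffun 'I_N -> 'I_3}) (k : 'I_N) : int :=
  \sum_(c : 'I_N | (c < k)%N) incr al x c.

Lemma plane_treeP al : plane_tree al ->
  (forall c, al c != c /\ al (al c) = c) /\ (#|porbits (al * turn N)| * 2 = N + 2)%N.
Proof.
by case/andP => /forallP h /eqP ->; split=> // c; have /andP[-> /eqP ->] := h c.
Qed.

Lemma tree_label0 al x (k : 'I_N) : val k = 0%N -> tree_label al x k = 0.
Proof. by move=> k0; rewrite /tree_label big1 // => c; rewrite k0. Qed.

Lemma tree_labelS al x (k k' : 'I_N) : val k' = (val k).+1 ->
  tree_label al x k' = tree_label al x k + incr al x k.
Proof.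
move=> E; rewrite /tree_label (bigD1 k) /=; last by rewrite E.
rewrite addrC; congr (_ + _); apply: eq_bigl => c.
by rewrite E ltnS -val_eqE /=; lia.
Qed.

Section Tree.
Variables (al : {perm 'I_N}) (x : {ffun 'I_N -> 'I_3}).
Hypothesis T : plane_tree al.

Let alK : forall c, al c != c /\ al (al c) = c. Proof. by have [] := plane_treeP T. Qed.

Lemma incr_al c : incr al x (al c) = - incr al x c.
Proof.
have [h1 h2] := alK c; rewrite /incr h2.
have : (al c < c)%N = ~~ (c < al c)%N.
  by rewrite -leqNgt [RHS]leq_eqVlt val_eqE (negPf h1).
by move=> ->; case: (c < al c)%N => /=; rewrite opprB.
Qed.

Lemma incr_step c : -1 <= incr al x c <= 1.
Proof.
rewrite /incr; have := ltn_ord (x c); have := ltn_ord (x (al c)); case: ifP => _; lia.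
Qed.

(** Increments summed along the contour only depend on the vertex: around the one
    face of the tree each edge is followed in both directions, so that the
    increments form a closed form. *)
Lemma tree_label_turn (k0 : 'I_N) c : val k0 = 0%N ->
  tree_label al x (turn N c) - tree_label al x c = incr al x c /\
  tree_label al x (turn N c) = tree_label al x (al c).
Proof.
move=> k00; pose t := RMap (al * turn N)%g al k0.
have [_ cV] := plane_treeP T.
have fE : faces t = porbits (turn N).
  by rewrite /faces /=; congr porbits; apply/permP => y; rewrite !permM (alK y).2.
have f1 : #|porbits (turn N)| = 1%N.
  have -> : porbits (turn N) = [set [set: 'I_N]%SET]%SET.
    apply/setP => X; rewrite inE; apply/imsetP/eqP => [[y _ ->]|->].
      by apply/setP => y'; rewrite inE turn_single.
    by exists k0 => //; apply/setP => y'; rewrite inE turn_single.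
  by rewrite cards1.
have conn : connected_map t.
  apply: (@inv_connected _ _ k0) => A cA Av Aa; apply/setP => y; rewrite inE.
  suff Ap d : (turn N d \in A) = (d \in A).
    by rewrite (porbit_inv (F := fun d => d \in A) Ap (turn_single k0 y)).
  by have := Av (al d); rewrite /= permM (alK d).2 => ->; rewrite -[al d]/(eperm t d) Aa.
have cE := card_edges (m := t) alK; rewrite card_ord in cE.
pose w c : rat := (incr al x c)%:~R.
have [|||h [hv he]] := @closed_form_exact rat _ t alK conn k0 w.
- by rewrite fE f1; apply/eqP; rewrite -(eqn_pmul2r (isT : 0 < 2)%N) !mulnDl cE /vertices /= cV; lia.
- by move=> d; rewrite /w /= incr_al rmorphN.
- move=> F; rewrite fE => /imsetP[y _ ->].
  have : \sum_(d in porbit (turn N) y) w d = - \sum_(d in porbit (turn N) y) w d.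
    rewrite {1}(reindex_inj (@perm_inj _ al)) /= -sumrN; apply: eq_big => d.
      by rewrite !turn_single.
    by rewrite /w incr_al rmorphN.
  by move: (\sum_(_ in _) _) => s; lra.
have hr d : h (turn N d) = h (al d) by have := hv (al d); rewrite /= permM (alK d).2.
have hE (k : 'I_N) : (tree_label al x k)%:~R = h k - h k0.
  case: k => k; elim: k => [|k IH] kN.
    by rewrite (_ : Ordinal kN = k0) ?subrr ?tree_label0 //; apply: val_inj.
  rewrite (tree_labelS _ _ (k := Ordinal (ltnW kN))) // rmorphD /= IH.
  have := he (Ordinal (ltnW kN)); rewrite /= /w => <-; rewrite -hr.
  have -> : turn N (Ordinal (ltnW kN)) = Ordinal kN.
    by apply: val_inj; rewrite /= permE /= modn_small.
  ring.
have lE : tree_label al x (turn N c) = tree_label al x (al c).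
  by apply: (@intr_inj rat); rewrite ?hE ?hr.
split=> //; apply: (@intr_inj rat); rewrite rmorphB /= !hE hr.
by have := he c; rewrite /= /w => <-; ring.
Qed.

Lemma tree_label_tree (k0 : 'I_N) : val k0 = 0%N ->
  labelled_tree (turn N) al (tree_label al x).
Proof.
move=> k00; split.
- exact: alK.
- exact: turn_single.
- by move=> c; have [] := tree_label_turn c k00.
- by move=> c; have [E1 E2] := tree_label_turn c k00; rewrite -E2 E1; exact: incr_step.
- by have [_ ->] := plane_treeP T; rewrite card_ord.
Qed.

End Tree.

Lemma tree_label_inj al x x' (k0 : 'I_N) : val k0 = 0%N -> plane_tree al ->
  x \in tree_incr al -> x' \in tree_incr al ->
  tree_label al x =1 tree_label al x' -> x = x'.
Proof.
move=> k00 T /pffun_onP[sx _] /pffun_onP[sx' _] E; apply/ffunP => c.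
have [h|h] := boolP (c < al c)%N; last first.
  by move/supportP: sx => ->; [move/supportP: sx' => ->|]; rewrite ?inE.
have [h1 _] := tree_label_turn x T c k00; have [h2 _] := tree_label_turn x' T c k00.
move: h1 h2; rewrite !E => -> ; rewrite /incr h => E'.
by apply/val_inj => /=; lia.
Qed.

Lemma tree_label_onto al l (k0 : 'I_N) : val k0 = 0%N ->
  labelled_tree (turn N) al l -> exists2 x, x \in tree_incr al &
    forall k, tree_label al x k = l k - l k0.
Proof.
move=> k00 T; have alK := lt_al T.
pose x : {ffun 'I_N -> 'I_3} := [ffun c : 'I_N => if (c < al c)%N then inord (absz (l (al c) - l c + 1)) else flat].
have xE c : incr al x c = l (al c) - l c.
  have [h1 h2] := alK c; rewrite /incr !ffunE h2.
  have := lt_step T c.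
  have : (al c < c)%N = ~~ (c < al c)%N.
    by rewrite -leqNgt [RHS]leq_eqVlt val_eqE (negPf h1).
  by move=> ->; case: (c < al c)%N => /= h3; rewrite inordK; lia.
exists x.
  apply/pffun_onP; split; last by move=> ? _.
  by apply/supportP => c; rewrite inE ffunE => /negPf ->.
move=> [k]; elim: k => [|k IH] kN.
  by rewrite (_ : Ordinal kN = k0) ?subrr ?tree_label0 //; apply: val_inj.
rewrite (tree_labelS _ _ (k := Ordinal (ltnW kN))) // IH xE -(lt_level T).
have -> : turn N (Ordinal (ltnW kN)) = Ordinal kN.
  by apply: val_inj; rewrite /= permE /= modn_small.
lia.
Qed.

(** A path, matching corners k and 2n - 1 - k. *)
Lemma plane_tree_exists (k0 : 'I_N) : exists al, plane_tree al.
Proof.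
pose al : {perm 'I_N} := perm (inv_inj (@rev_ordK N)).
have alK c : al c != c /\ al (al c) = c.
  rewrite !permE rev_ordK; split=> //; rewrite -val_eqE /=.
  by have := ltn_ord c; lia.
exists al; apply/andP; split; first by apply/forallP => c; have [-> ->] := alK c; rewrite eqxx.
have up := tree_vertices_le k0 alK (@turn_single N); rewrite card_ord in up.
rewrite eqn_leq up /=.
(* the distance to the end of the path where the contour starts *)
pose F (k : 'I_N) : 'I_n.+1 := inord (minn k (N - k)).
have := @card_porbits_ge _ _ (al * turn N)%g F [set: 'I_n.+1]%SET.
rewrite cardsT card_ord => W; suff : (n.+1 <= #|porbits (al * turn N)|)%N.
  by move: #|_| => p; lia.
apply: W => [k|a _].
  rewrite permM permE [al k]permE /F; congr inord; rewrite /=.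
  have := ltn_ord k; case: (val k) => [|j] jN.
    by rewrite subn1 prednK ?modnn ?min0n //; lia.
  rewrite modn_small; last by lia.
  by rewrite minnC; congr minn; lia.
have aN : (a < N)%N by have := ltn_ord a; have := ltn_ord k0; lia.
by exists (Ordinal aN); rewrite /F /= (minn_idPl _) ?inord_val //; have := ltn_ord a; lia.
Qed.

Lemma card_half al : plane_tree al -> #|[pred c : 'I_N | (c < al c)%N]| = n.
Proof.
case/plane_treeP => alK _.
have E : [set c : 'I_N | (al c < c)%N] = al @: [set c : 'I_N | (c < al c)%N].
  apply/setP => c; rewrite inE; apply/idP/imsetP => [h|[y]].
    by exists (al c); rewrite ?inE ?(alK c).2.
  by rewrite inE => h ->; rewrite (alK y).2.
have := cardsC [set c : 'I_N | (c < al c)%N].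
have -> : ~: [set c : 'I_N | (c < al c)%N] = [set c : 'I_N | (al c < c)%N].
  apply/setP => c; rewrite !inE -leqNgt leq_eqVlt val_eqE.
  by have [/negPf ->] := alK c.
rewrite E card_imset; last exact: perm_inj.
rewrite card_ord -[X in _ -> X = _]cardsE; move: #|_| => a; lia.
Qed.

End Codes.

(** * Counting isomorphism classes by codes *)

(** A cardinal comparison by a relation in place of an injection, so that no
    choices are made when it is applied. *)
Lemma card_le_rel (A B : finType) (X : {set A}) (Y : {set B}) (r : A -> B -> Prop) :
  (forall a, a \in X -> exists2 b, b \in Y & r a b) ->
  (forall a a' b, a \in X -> a' \in X -> r a b -> r a' b -> a = a') ->
  (#|X| <= #|Y|)%N.
Proof.
move=> h inj.
have [a|f hf] := @choice A (option B)
  (fun a ob => a \in X -> exists b, [/\ ob = Some b, b \in Y & r a b]).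
  have [aX|aX] := boolP (a \in X); last by exists None => aX'; case/negP: aX.
  by have [b bY rab] := h a aX; exists (Some b) => _; exists b.
rewrite -(card_in_imset (f := f) (D := X)).
  rewrite -(card_imset (mem Y) (@Some_inj _ : injective (@Some B))); apply: subset_leq_card.
  apply/fintype.subsetP => ob /imsetP[a aX ->]; have [b [-> bY _]] := hf a aX.
  exact: imset_f.
move=> a a' aX a'X E; have [b [Eb _ rb]] := hf a aX; have [b' [Eb' _ rb']] := hf a' a'X.
by apply: (inj a a' b) => //; move: E; rewrite Eb Eb' => -[->].
Qed.

Section Classes.
Variable n : nat.
Local Notation N := (2 * n)%N.
Local Notation D := 'I_(4 * n).

(** A sign, telling which of the two darts of its edge is the root, a tree and its
    increments. *)
Definition tree_code : finType := (bool * {perm 'I_N} * {ffun 'I_N -> 'I_3})%type.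

Definition tree_codes : {set tree_code} :=
  [set t : tree_code | plane_tree t.1.2 && (t.2 \in tree_incr t.1.2)].

Definition code_label (t : tree_code) : 'I_N -> int := tree_label t.1.2 t.2.

Definition code_of (t : tree_code) (m : rmap D) (u : 'I_N -> D) : Prop :=
  coded m (turn N) t.1.2 (code_label t) u /\
  forall k0, val k0 = 0%N -> rootd m = if t.1.1 then u k0 else eperm m (u k0).

Lemma card_quad_faces (m : rmap D) : quadrangulation m -> #|faces m| == n.
Proof. by move=> Q; have [+ _ _] := quad_counts Q; rewrite card_ord; move: #|_| => f; lia. Qed.

Lemma rooted_quadsP (C : {set rmap D}) : C \in rooted_quads n ->
  exists2 m, quadrangulation m & C = [set m' | quadrangulation m' && map_iso m m'].
Proof.
case/imsetP => m; rewrite inE => /andP[Q _] ->; exists m => //.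
apply/setP => m'; rewrite !inE; case Q' : (quadrangulation m') => //=.
by rewrite card_quad_faces.
Qed.

Lemma rooted_quads_class (m : rmap D) : quadrangulation m ->
  exists2 C, C \in rooted_quads n & C = [set m' | quadrangulation m' && map_iso m m'].
Proof.
move=> Q; exists [set m' | quadrangulation m' && map_iso m m'] => //.
apply/imsetP; exists m; first by rewrite inE Q card_quad_faces.
by apply/setP => m'; rewrite !inE; case Q' : (quadrangulation m'); rewrite //= card_quad_faces.
Qed.

Lemma map_iso_eqv (m m' m'' : rmap D) : map_iso m m' ->
  map_iso m' m'' = map_iso m m''.
Proof. by move=> h; case: (map_iso_equiv m m' m'') => _ ->. Qed.

Lemma code_of_iso t (m m' : rmap D) u : map_iso m m' -> code_of t m u ->
  exists u', code_of t m' u'.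
Proof.
case/existsP => g /and3P[/forallP gv /forallP ge /eqP gr] [K hr].
have {}gv d : g (vperm m d) = vperm m' (g d) by apply/eqP.
have {}ge d : g (eperm m d) = eperm m' (g d) by apply/eqP.
exists (g \o u); split; last first.
  by move=> k0 h; rewrite -gr (hr k0 h) /=; case: ifP => _; rewrite ?ge.
split=> /=.
- exact: inj_comp (@perm_inj _ g) (cod_inj K).
- move=> d; have [c Ec] := cod_cover K (g^-1%g d); exists c.
  by rewrite -ge -[d](permKV g); case: Ec => ->; [left|right].
- by move=> c c'; rewrite -ge (inj_eq perm_inj) (cod_disj K).
- by move=> c h; rewrite -ge -gv (cod_down K).
- by move=> c h; rewrite -gv (cod_side K).
- by move=> c h; rewrite -!ge -gv (cod_next K).
- by move=> c h; rewrite -ge -gv (cod_up K).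
Qed.

Hypothesis hn : (0 < n)%N.
Let N_gt0 : (0 < N)%N. Proof. by lia. Qed.
Let k0 : 'I_N := Ordinal N_gt0.

Lemma codes_tree t : t \in tree_codes -> labelled_tree (turn N) t.1.2 (code_label t).
Proof. by rewrite inE => /andP[T _]; apply: (@tree_label_tree _ _ _ T k0). Qed.

Lemma code_of_exists t : t \in tree_codes -> exists m u, quadrangulation m /\ code_of t m u.
Proof.
move=> /codes_tree T.
have [|m [u [eK K hr]]] := @coded_exists D _ _ _ _ k0 t.1.1 T; first by rewrite !card_ord; lia.
exists m, u; split; first by have [] := coded_quad eK T K k0.
split=> // k h; rewrite (_ : k = k0) //; exact: val_inj.
Qed.

Lemma code_exists (m : rmap D) L z : quadrangulation m -> labelling m L z ->
  exists t u, [/\ t \in tree_codes, code_of t m u &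
    forall d, d \notin porbit (vperm m) z -> exists k k', code_label t k - code_label t k' = L d - L z - 1].
Proof.
move=> Q lab; have eK := planar_eK (quad_planar Q).
pose b := desc m L (rootd m).
pose r := if b then rootd m else eperm m (rootd m).
have dr : desc m L r.
  by rewrite /r /b; case: ifPn => // h; rewrite (desc_e Q lab).
have cD : #|{: D}| = (4 * n)%N by rewrite card_ord.
have [al [T K]] := labelling_coded Q lab cD dr.
set u := @contour_dart _ m L r n in T K.
have [x xs xE] := tree_label_onto (erefl : val k0 = 0%N) T.
have xE' : tree_label al x = fun k => (L \o u) k - (L \o u) k0 by apply/funext => k; rewrite xE.
have nE : next_low (turn N) (tree_label al x) = next_low (turn N) (L \o u).
  apply/funext => c; rewrite /next_low; congr first_hit; apply/funext => y.
  by rewrite !xE lerD2r.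
exists ((b, al), x), u; split.
- rewrite inE /= xs andbT; apply/andP; split; last by have /eqP := lt_vertices T; rewrite card_ord.
  by apply/forallP => c; have [-> ->] := lt_al T c; rewrite eqxx.
- split.
    rewrite /code_label /=; split; rewrite ?nE.
    + exact: (cod_inj K).
    + exact: (cod_cover K).
    + exact: (cod_disj K).
    + by move=> c; rewrite !xE ltrD2r; apply: (cod_down K).
    + by move=> c; rewrite !xE lerD2r; apply: (cod_side K).
    + by move=> c; rewrite !xE lerD2r; apply: (cod_next K).
    + by move=> c; rewrite !xE ltrD2r; apply: (cod_up K).
  move=> k hk; rewrite /= /u /contour_dart; have -> : nat_of_ord k = 0%N := hk.
  by rewrite /= /r; case: (b); rewrite ?(eK _).2.
move=> d /(lab_desc lab)[d' dd' h].
have [k Ek] := contour_dart_onto Q lab cD dr h.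
have hz : desc m L (eperm m z).
  by rewrite /desc (eK _).2 (lab_z lab (porbit_id _ _)); lia.
have [k' Ek'] := contour_dart_onto Q lab cD dr hz.
exists k, k'; rewrite /code_label !xE /= /u -Ek -Ek' (lab_orbit lab dd').
by rewrite (lab_z lab (porbit_id _ _)); lia.
Qed.

Lemma code_of_iso_maps t (m m' : rmap D) u u' : t \in tree_codes ->
  quadrangulation m -> quadrangulation m' -> code_of t m u -> code_of t m' u' -> map_iso m m'.
Proof.
move=> /codes_tree T Q Q' [K hr] [K' hr'].
have [g [gv ge gu]] := coded_iso (planar_eK (quad_planar Q)) (planar_eK (quad_planar Q')) T K K'.
apply/existsP; exists g; apply/and3P; split.
- by apply/forallP => d; rewrite gv.
- by apply/forallP => d; rewrite ge.
- by rewrite (hr k0 erefl) (hr' k0 erefl); case: ifP => _; rewrite ?ge gu.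
Qed.

Lemma code_of_inj (t t' : tree_code) (m : rmap D) u u' c c' : t \in tree_codes -> t' \in tree_codes ->
  quadrangulation m -> code_of t m u -> code_of t' m u' ->
  (forall x, code_label t c <= code_label t x) ->
  (forall x, code_label t' c' <= code_label t' x) ->
  t.1.1 = t'.1.1 -> eperm m (u c) = eperm m (u' c') -> t = t'.
Proof.
move=> tC tC' Q [K hr] [K' hr'] minc minc' Eb E.
have T := codes_tree tC; have T' := codes_tree tC'.
have u0 : u k0 = u' k0.
  have := hr k0 erefl; rewrite (hr' k0 erefl) Eb; case: ifP => _ // /perm_inj //.
have [Ea El] := coded_unique (quad_planar Q) T T' K K' u0 minc minc' E.
case: t t' tC tC' Eb Ea El {hr hr' K K' T T' minc minc'} => [[b al] x] [[b' al'] x'] /=.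
rewrite !inE /= => /andP[T xs] /andP[_ xs'] -> Ea; rewrite -Ea in xs' *; rewrite /code_label /= => El.
congr (_, _); apply: (tree_label_inj (erefl : val k0 = 0%N) T xs xs') => k.
by have := El k; rewrite !(@tree_label0 _ _ _ k0) // !subr0.
Qed.

(** Within one class, a code is determined by its sign and by one dart leaving the
    origin of its labelling, whence the factor 2 * 4n. *)
Lemma card_codes : (#|tree_codes| <= 8 * n * #|rooted_quads n|)%N.
Proof.
pose Y := finset.setX [set: bool]%SET (finset.setX (rooted_quads n) [set: D]%SET).
have <- : #|Y| = (8 * n * #|rooted_quads n|)%N.
  by rewrite !cardsX !cardsT card_bool card_ord; lia.
apply: (@card_le_rel _ _ _ _ (fun (t : tree_code) (y : bool * ({set rmap D} * D)) =>
  y.1 = t.1.1 /\ exists m u c, [/\ [pick m in y.2.1] = Some m, quadrangulation m, code_of t m u,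
    forall x, code_label t c <= code_label t x & y.2.2 = eperm m (u c)])).
- move=> t tC; have [m [u [Q tu]]] := code_of_exists tC.
  have [C CP CE] := rooted_quads_class Q.
  have [m' pm] : exists m', [pick m in C] = Some m'.
    case: pickP => [m' _|/(_ m)]; first by exists m'.
    by have [r _] := map_iso_equiv m m m; rewrite CE inE Q r.
  have : m' \in C by move: pm; case: pickP => // x xC [<-].
  rewrite CE inE => /andP[Q' mm']; have [u' tu'] := code_of_iso mm' tu.
  have [c _ minc] := @arg_minP _ int _ k0 predT (code_label t) isT.
  exists (t.1.1, (C, eperm m' (u' c))); first by rewrite !inE CP.
  by split=> //; exists m', u', c; split=> // x; apply: minc.
- move=> t t' [b [C d]] tC tC' /= [-> [m [u [c [pm Q tu minc ->]]]]].
  move=> [Eb [m' [u' [c' [pm' _ tu' minc' E]]]]].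
  move: pm' tu' E; rewrite pm => -[<-] tu' E.
  exact: (code_of_inj tC tC' Q tu tu').
Qed.

Variables (R : realType) (M : R).

(** The diameter of the map exceeds M. *)
Definition far (m : rmap D) : Prop :=
  exists z L d, labelling m L z /\ M < (L d - L z)%:~R.

(** The loss of 1 comes from the origin of the labelling, which lies one level below
    the corners of the tree. *)
Definition wide (t : tree_code) : bool :=
  `[< exists k k', M - 1 < (code_label t k - code_label t k')%:~R >].

Lemma card_far_classes : 0 <= M ->
  (#|[set C in rooted_quads n | `[< exists2 m, m \in C & far m >]]|
    <= #|[set t in tree_codes | wide t]|)%N.
Proof.
move=> M0; apply: (@card_le_rel _ _ _ _ (fun (C : {set rmap D}) (t : tree_code) =>
  exists m u, [/\ m \in C, quadrangulation m, t \in tree_codes & code_of t m u])).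
- move=> C; rewrite inE => /andP[CP /asboolP[m mC [z [L [d [lab far]]]]]].
  have [m0 Q0 CE] := rooted_quadsP CP.
  have Q : quadrangulation m by move: mC; rewrite CE inE => /andP[].
  have [t [u [tC tu h]]] := code_exists Q lab.
  have dz : d \notin porbit (vperm m) z.
    apply/negP => /(lab_orbit lab) E; move: far; rewrite E subrr => far.
    by have := lt_le_trans far M0; rewrite ltxx.
  exists t; last by exists m, u.
  rewrite inE tC; apply/asboolP; have [k [k' E]] := h d dz; exists k, k'.
  by rewrite E rmorphB /= ltrD2r.
- move=> C C' t; rewrite inE => /andP[CP _]; rewrite inE => /andP[CP' _].
  move=> [m [u [mC Q tC tu]]] [m' [u' [mC' Q' _ tu']]].
  have I := code_of_iso_maps tC Q Q' tu tu'.
  have [m0 _ CE] := rooted_quadsP CP; have [m0' _ CE'] := rooted_quadsP CP'.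
  move: mC mC'; rewrite CE CE' !inE => /andP[_ i1] /andP[_ i2].
  apply/setP => x; rewrite !inE; congr (_ && _).
  by rewrite -(map_iso_eqv x i1) -(map_iso_eqv x i2) (map_iso_eqv x I).
Qed.

End Classes.

(** * Labels of a random tree are small *)

Lemma card_pairs (A B : finType) (P : pred A) (S : A -> {set B}) :
  #|[set t : A * B | P t.1 && (t.2 \in S t.1)]| = (\sum_(a | P a) #|S a|)%N.
Proof.
under eq_bigr => a _ do rewrite -sum1_card.
rewrite pair_big_dep /= -sum1_card; apply: eq_bigl => t; by rewrite inE.
Qed.

Lemma expR_le_quadratic (R : realType) (y : R) : `|y| <= 1 / 2 ->
  expR y <= 1 + y + 2 * y ^+ 2.
Proof.
rewrite ler_norml => /andP[y1 y2].
have h : 0 < 1 - y by lra.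
have : expR y * (1 - y) <= 1.
  have := expR_ge1Dx (- y); rewrite expRN => h'.
  have e0 := expR_gt0 y.
  by rewrite -[leRHS](mulfV (lt0r_neq0 e0)) ler_pM2l.
rewrite -ler_pdivlMr // => /le_trans; apply.
rewrite ler_pdivrMr //; have := sqr_ge0 y; rewrite expr2; nra.
Qed.

(** Near 0 the Laplace transform of a uniform variable on -1, 0, 1 is subgaussian. *)
Lemma expR_three (R : realType) (y th : R) : `|y| <= th -> th <= 1 / 2 ->
  expR (- y) + 1 + expR y <= 3 * expR (2 * th ^+ 2).
Proof.
move=> yt t2; have y2 := le_trans yt t2.
have h1 := expR_le_quadratic y2; have := @expR_le_quadratic _ (- y).
rewrite normrN sqrrN => /(_ y2) h2.
have := expR_ge1Dx (2 * th ^+ 2).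
have : y ^+ 2 <= th ^+ 2 by rewrite -(real_normK (num_real y)) lerXn2r ?nnegrE // (le_trans _ yt).
have := sqr_ge0 y; lra.
Qed.

Section Tail.
Variables (R : realType) (n : nat).
Hypothesis hn : (0 < n)%N.
Local Notation N := (2 * n)%N.

(** An edge contributes to the label of k only if the contour up to k passes along
    one of its two sides but not along the other. *)
Lemma tree_label_half (al : {perm 'I_N}) (x : {ffun 'I_N -> 'I_3}) (k : 'I_N) : plane_tree al ->
  tree_label al x k = \sum_(c : 'I_N | (c < al c)%N)
    ((c < k)%N%:Z - (al c < k)%N%:Z) * ((x c)%:Z - 1).
Proof.
move=> T; have [alK _] := plane_treeP T.
rewrite /tree_label big_mkcond (bigID (fun c : 'I_N => (c < al c)%N)) /=.
rewrite [X in _ + X](reindex_inj (@perm_inj _ al)) /=.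
have sw c : ~~ (al c < al (al c))%N = (c < al c)%N.
  have [h1 h2] := alK c; rewrite h2 -leqNgt leq_eqVlt val_eqE eq_sym.
  by rewrite (negPf h1).
rewrite [X in _ + X](eq_bigl _ _ sw) -big_split /=; apply: eq_bigr => c hc.
rewrite (incr_al x T) /incr hc; do 2 case: (_ < k)%N => /=; ring.
Qed.

Lemma card_tree_incr (al : {perm 'I_N}) : plane_tree al ->
  #|[set x | x \in tree_incr al]| = (3 ^ n)%N.
Proof.
by move=> T; rewrite cardsE card_pffun_on card_half // card_ord.
Qed.

(** The increments being independent, the Laplace transform is a product over the
    edges. *)
Lemma tree_label_mgf (al : {perm 'I_N}) (k : 'I_N) (th : R) : plane_tree al -> `|th| <= 1 / 2 ->
  \sum_(x in tree_incr al) expR (th * (tree_label al x k)%:~R) <=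
    (3 ^ n)%N%:R * expR (2 * n%:R * th ^+ 2).
Proof.
move=> T th2.
pose s (c : 'I_N) : int := (c < k)%N%:Z - (al c < k)%N%:Z.
pose F (c : 'I_N) (i : 'I_3) : R := expR (th * ((s c)%:~R * ((i : nat)%:R - 1))).
have -> : \sum_(x in tree_incr al) expR (th * (tree_label al x k)%:~R) =
    \prod_(c : 'I_N | (c < al c)%N) \sum_(i : 'I_3) F c i.
  rewrite (big_distr_big flat) /=; apply: eq_bigr => x _.
  rewrite (tree_label_half x k T) rmorph_sum mulr_sumr expR_sum /=.
  apply: eq_bigr => c _; rewrite /F rmorphM /=; congr (expR (th * (_ * _))).
  by rewrite rmorphB.
have -> : (3 ^ n)%N%:R * expR (2 * n%:R * th ^+ 2) =
    \prod_(c : 'I_N | (c < al c)%N) (3 * expR (2 * th ^+ 2)) :> R.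
  rewrite prodr_const card_half // exprMn natrX -expRM_natl; congr (_ * expR _); ring.
apply: ler_prod => c _; rewrite !big_ord_recl big_ord0 addr0 /F /=.
apply/andP; split; first by rewrite !addr_ge0 ?expR_ge0.
have := @expR_three _ (th * (s c)%:~R) `|th| _ th2.
rewrite real_normK ?num_real // /bump /= => h.
have -> : th * ((s c)%:~R * (0 - 1)) = - (th * (s c)%:~R) by ring.
have -> : th * ((s c)%:~R * (1 - 1)) = 0 by ring.
have -> : th * ((s c)%:~R * ((1 + 1)%N%:R - 1)) = th * (s c)%:~R by rewrite natrD; ring.
rewrite expR0 addrA; apply: h.
by rewrite normrM ler_piMr // -intr_norm lerz1 /s; do 2 case: (_ < k)%N.
Qed.

Lemma tree_label_tail (al : {perm 'I_N}) (k : 'I_N) (th a : R) (b : bool) :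
  plane_tree al -> 0 <= th <= 1 / 2 ->
  #|[set x in tree_incr al | a <= (-1) ^+ b * (tree_label al x k)%:~R]|%:R <=
    (3 ^ n)%N%:R * expR (2 * n%:R * th ^+ 2 - th * a).
Proof.
move=> T /andP[th0 th2].
have nb : `|(-1) ^+ b * th| <= 1 / 2.
  suff -> : `|(-1) ^+ b * th| = th by [].
  by rewrite normrM normrX normrN normr1 expr1n mul1r ger0_norm.
have := tree_label_mgf k T nb.
rewrite exprMn sqrr_sign mul1r expRD expRN mulrA ler_pdivlMr ?expR_gt0 //.
apply: le_trans; rewrite -sumr_const mulr_suml.
rewrite [leRHS](bigID (fun x => a <= (-1) ^+ b * (tree_label al x k)%:~R)) /=.
rewrite -[leLHS]addr0; apply: lerD; last by apply: sumr_ge0 => x _; apply: expR_ge0.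
rewrite [leLHS](eq_bigl (fun x => (x \in tree_incr al) && (a <= (-1) ^+ b * (tree_label al x k)%:~R))); last by move=> x; rewrite inE.
apply: ler_sum => x /andP[_ h]; rewrite mul1r ler_expR.
rewrite [leRHS](_ : _ = th * ((-1) ^+ b * (tree_label al x k)%:~R)); last by ring.
by rewrite ler_wpM2l.
Qed.

Local Notation wide := (@wide n R).

(** The parameter 1 / (2 sqrt n) makes the quadratic term a constant; 4n counts the
    corners and the two signs. *)
Lemma card_wide (M : R) : 1 <= M ->
  #|[set t in tree_codes n | wide M t]|%:R <=
    4 * n%:R * expR (1 / 2 - (M - 1) / (4 * Num.sqrt n%:R)) * #|tree_codes n|%:R.
Proof.
move=> M1; set K : R := expR _.
have n0 : 0 < n%:R :> R by rewrite ltr0n.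
pose th : R := (2 * Num.sqrt n%:R)^-1.
have s1 : 1 <= Num.sqrt n%:R :> R by rewrite -[leLHS]sqrtr1 ler_wsqrtr // ler1n.
have th2 : 0 <= th <= 1 / 2.
  rewrite /th invr_ge0 mulr_ge0 ?sqrtr_ge0 //= mul1r lef_pV2 ?posrE //; lra.
have KE : expR (2 * n%:R * th ^+ 2 - th * ((M - 1) / 2)) = K.
  congr expR; rewrite /th exprVn exprMn sqr_sqrtr ?ler0n //.
  have s0 : Num.sqrt n%:R != 0 :> R by lra.
  have n00 : n%:R != 0 :> R by lra.
  by field; apply/andP.
pose W (al : {perm 'I_N}) := [set x in tree_incr al | [exists k, [exists b : bool,
  (M - 1) / 2 <= (-1) ^+ b * (tree_label al x k)%:~R]]].
have WB al : plane_tree al -> #|W al|%:R <= 4 * n%:R * K * (3 ^ n)%N%:R.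
  move=> T; pose V (p : 'I_N * bool) :=
    [set x in tree_incr al | (M - 1) / 2 <= (-1) ^+ p.2 * (tree_label al x p.1)%:~R].
  have -> : W al = \bigcup_(p : 'I_N * bool) V p.
    apply/setP => x; rewrite inE; apply/andP/bigcupP => [[xi]|[[k b] _]].
      by case/existsP => k /existsP[b h]; exists (k, b); rewrite // inE xi.
    rewrite inE /= => /andP[-> h]; split=> //.
    by apply/existsP; exists k; apply/existsP; exists b.
  have : (#|\bigcup_(p : 'I_N * bool) V p| <= \sum_(p : 'I_N * bool) #|V p|)%N.
    apply: (big_ind2 (fun (A : {set {ffun 'I_N -> 'I_3}}) k => (#|A| <= k)%N)) => //.
      by rewrite cards0.
    move=> A k B j hA hB; exact: leq_trans (leq_card_setU A B) (leq_add hA hB).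
  rewrite -(ler_nat R) natr_sum => /le_trans; apply.
  apply: (@le_trans _ _ (\sum_(p : 'I_N * bool) (3 ^ n)%N%:R * K)).
    by apply: ler_sum => p _; rewrite -KE; apply: tree_label_tail.
  rewrite sumr_const card_prod card_bool card_ord -[_ *+ _]mulr_natl !natrM.
  by rewrite le_eqVlt; apply/orP; left; apply/eqP; ring.
have W_wide : [set t in tree_codes n | wide M t] \subset
    [set t : tree_code n | plane_tree t.1.2 && (t.2 \in W t.1.2)].
  apply/fintype.subsetP => t; rewrite inE => /andP[+ /asboolP[k [k' h]]].
  rewrite !inE => /andP[-> ->] /=; move: h; rewrite /code_label rmorphB /=.
  set a := (tree_label _ _ k)%:~R; set b := (tree_label _ _ k')%:~R => h.
  (* of two labels that differ by M - 1, one exceeds half of it, up to sign *)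
  have [ha|ha] := leP ((M - 1) / 2) a.
    by apply/existsP; exists k; apply/existsP; exists false; rewrite expr0 mul1r.
  apply/existsP; exists k'; apply/existsP; exists true; rewrite expr1 mulN1r -/b.
  lra.
have := subset_leq_card W_wide; rewrite -(ler_nat R) => /le_trans; apply.
rewrite (card_pairs (fun a : bool * {perm 'I_N} => plane_tree a.2) (fun a => W a.2)).
have -> : #|tree_codes n| = (\sum_(a : bool * {perm 'I_N} | plane_tree a.2) 3 ^ n)%N.
  rewrite -(eq_bigr _ (fun a T => card_tree_incr T)).
  rewrite -(card_pairs (fun a : bool * {perm 'I_N} => plane_tree a.2)
     (fun a => [set x | x \in tree_incr a.2])).
  by apply: eq_card => t; rewrite !inE.
rewrite !natr_sum mulr_sumr; apply: ler_sum => a T; exact: WB.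
Qed.

End Tail.

(** * Mixing of the lazy walk from the radius *)

Section Walk.
Variables (R : realType) (D : finType) (m : rmap D) (L : D -> int) (z : D).
Local Notation v := (vperm m).
Local Notation e := (eperm m).
Local Notation o := (porbit (vperm m)).
Hypothesis Q : quadrangulation m.
Hypothesis lab : labelling m L z.
Implicit Types (g h : {set D} -> R) (x y : {set D}).

Let eK d : e (e d) = d. Proof. by have [] := planar_eK (quad_planar Q) d. Qed.

Lemma vertex_orbit x d : x \in vertices m -> d \in x -> o d = x.
Proof. by case/imsetP => d' _ ->; rewrite -eq_porbit_mem => /eqP. Qed.

Lemma sum_darts (F : D -> R) : \sum_d F d = \sum_(x in vertices m) \sum_(d in x) F d.
Proof.
transitivity (\sum_(d in [set: D]%SET) F d); first by apply: eq_bigl => d; rewrite inE.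
by rewrite (set_partition_big _ (porbits_partition v)).
Qed.

Lemma sum_rev (F : D -> R) : \sum_d F (e d) = \sum_d F d.
Proof. by rewrite [RHS](reindex_inj (@perm_inj _ e)). Qed.

Lemma deg_gt0 x : x \in vertices m -> 0 < (deg x)%:R :> R.
Proof. by case/imsetP => d _ ->; rewrite ltr0n /deg lt0n card_porbit_neq0. Qed.

Definition neighbour_mean g x : R := (\sum_(d in x) g (o (e d))) / (deg x)%:R.
Local Notation K := neighbour_mean.

Lemma no_loop x d : x \in vertices m -> d \in x -> e d \notin x.
Proof.
move=> xV dx; apply/negP => edx; have E := vertex_orbit xV dx.
have := lab_orbit lab (d := d) (d' := e d); rewrite E => /(_ edx).
by have := lab_e lab d; lia.
Qed.

(** An edge between x and y has exactly one dart from x to y. *)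
Lemma multE x y : x \in vertices m -> y \in vertices m -> x != y ->
  mult m x y = #|[set d in x | e d \in y]|.
Proof.
move=> xV yV xy; rewrite -(card_in_imset (f := porbit e)); last first.
  move=> d d'; rewrite !inE => /andP[dx edy] /andP[d'x ed'y] E.
  have : d \in porbit e d' by rewrite -E porbit_id.
  rewrite porbit_involution ?eK //.
  rewrite !inE => /orP[/eqP //|/eqP Ed]; case/eqP: xy.
  by rewrite -(vertex_orbit xV dx) -(vertex_orbit yV ed'y) Ed.
apply: eq_card => X; rewrite !inE; apply/andP/imsetP.
  case=> /imsetP[d0 _ ->] /existsP[d /and3P[dX dx dy]].
  by exists d; rewrite ?inE ?dx //; apply/eqP; rewrite eq_sym eq_porbit_mem.
case=> d; rewrite inE => /andP[dx dy] ->; split; first by apply: imset_f.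
by apply/existsP; exists d; rewrite porbit_id dx.
Qed.

Lemma lazy_pE g x : x \in vertices m ->
  \sum_(y in vertices m) lazy_p R m x y * g y = (g x + K g x) / 2.
Proof.
move=> xV; have d0 := deg_gt0 xV.
rewrite (bigD1 x) //= {1}/lazy_p eqxx mulrDl [_ * g x]mulrC mulrA mulr1; congr (_ + _).
transitivity (\sum_(y in vertices m | y != x) (\sum_(d in x) (if e d \in y then g y else 0)) / (2 * (deg x)%:R)).
  apply: eq_bigr => y /andP[yV yx]; rewrite /lazy_p eq_sym (negPf yx) multE //; last by rewrite eq_sym.
  rewrite -big_mkcondr sumr_const mulrAC -[g y *+ _]mulr_natl; congr (_ * _ / _).
  by congr (_%:R); apply: eq_card => d; rewrite !inE.
rewrite -mulr_suml exchange_big /= /K -mulrA -invfM mulrC [RHS]mulrC; congr (_^-1 * _); first by rewrite mulrC.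
apply: eq_bigr => d dx; rewrite -big_mkcondr /=.
rewrite (big_pred1 (o (e d))) // => y /=.
apply/andP/eqP => [[/andP[yV yx] edy]|->]; first by rewrite (vertex_orbit yV edy).
split; last exact: porbit_id.
apply/andP; split; first by apply: imset_f.
by apply/eqP => E; have := no_loop xV dx; rewrite -E porbit_id.
Qed.

(** The scalar product for the stationary measure, multiplied by 4n. *)
Definition dot g h : R := \sum_d g (o d) * h (o d).

Lemma dot_mean g h : dot h (K g) = \sum_d h (o d) * g (o (e d)).
Proof.
rewrite /dot !sum_darts; apply: eq_bigr => x xV.
rewrite (eq_bigr (fun=> h x * K g x)); last by move=> d dx; rewrite (vertex_orbit xV dx).
rewrite [RHS](eq_bigr (fun d => h x * g (o (e d)))); last by move=> d dx; rewrite (vertex_orbit xV dx).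
rewrite sumr_const -mulr_sumr -[_ *+ _]mulr_natl /K -/(deg x).
by have := deg_gt0 xV => d0; field; rewrite lt0r_neq0.
Qed.

(** Sums over darts count each edge twice. *)
Definition energy g : R := \sum_d (g (o d) - g (o (e d))) ^+ 2.

Lemma energyE g : energy g = 2 * dot g g - 2 * dot g (K g).
Proof.
rewrite dot_mean /energy /dot.
have -> : 2 * (\sum_d g (o d) * g (o d)) =
    \sum_d g (o d) * g (o d) + \sum_d g (o (e d)) * g (o (e d)).
  by rewrite (sum_rev (fun d => g (o d) * g (o d))) mulr_natl mulr2n.
by rewrite mulr_sumr -sumrN -!big_split /=; apply: eq_bigr => d _; ring.
Qed.

Lemma mean_contracts g : dot (K g) (K g) <= dot g g.
Proof.
have h1 : dot (K g) (K g) = \sum_d K g (o d) * g (o (e d)) by rewrite dot_mean.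
have h2 : \sum_d K g (o d) * g (o (e d)) <=
    \sum_d (K g (o d) * K g (o d) + g (o (e d)) * g (o (e d))) / 2.
  apply: ler_sum => d _; have := sqr_ge0 (K g (o d) - g (o (e d))); rewrite expr2; nra.
move: h2; rewrite -h1 -mulr_suml big_split /= (sum_rev (fun d => g (o d) * g (o d))) -/(dot _ _) -/(dot _ _).
lra.
Qed.

(** The mean K contracts, so with P = (1 + K) / 2 the norm of P g is at most that of
    g by half of the scalar product of g with (1 - K) g. *)
Lemma lazy_energy g : dot (fun x => (g x + K g x) / 2) (fun x => (g x + K g x) / 2) <=
  dot g g - energy g / 4.
Proof.
have -> : dot (fun x => (g x + K g x) / 2) (fun x => (g x + K g x) / 2) =
    (dot g g + 2 * dot g (K g) + dot (K g) (K g)) / 4.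
  rewrite /dot mulr_sumr -!big_split /= mulr_suml; apply: eq_bigr => d _.
  by field.
have := mean_contracts g; rewrite energyE; lra.
Qed.

(** A geodesic to z crosses each level once, so its edges are distinct, and
    Cauchy-Schwarz over the a edges gives the factor a. *)
Lemma geodesic_bound g (a : nat) d : L d = L z + a%:Z ->
  (g (o d) - g (o z)) ^+ 2 <=
    a%:R * \sum_(d' | (L (e d') < L d') && (L d' <= L z + a%:Z)) (g (o d') - g (o (e d'))) ^+ 2.
Proof.
elim: a d => [|a IH] d Ld.
  have : d \in o z.
    apply: contraT => /(lab_desc lab)[d' dd' h].
    by have := lab_min lab (e d'); have := lab_orbit lab dd'; lia.
  by rewrite -eq_porbit_mem => /eqP ->; rewrite subrr expr0n /= mul0r.
have dz : d \notin o z by apply/negP => /(lab_orbit lab); lia.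
have [d' dd' h] := lab_desc lab dz; have Ed := lab_orbit lab dd'.
have -> : o d = o d' by apply/eqP; rewrite eq_sym eq_porbit_mem.
have Ld' : L (e d') = L z + a%:Z by have := lab_e lab d'; lia.
have := IH _ Ld'.
set T := \sum_(_ | _) _; set T' := \sum_(_ | _) _ => hw.
have TT : T + (g (o d') - g (o (e d'))) ^+ 2 <= T'.
  rewrite /T' (bigD1 d') /=; last by rewrite h; lia.
  rewrite [leLHS]addrC lerD2l /T big_mkcond [leRHS]big_mkcond /=; apply: ler_sum => t _.
  case: ifPn => [/andP[h1 h2]|_]; last by case: ifP => _ //; apply: sqr_ge0.
  have -> : ((L (e t) < L t) && (L t <= L z + a.+1%:Z)) && (t != d').
    by rewrite h1 /=; apply/andP; split; [lia | apply/eqP => E; move: h2; rewrite E; lia].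
  by [].
have T0 : 0 <= T by apply: sumr_ge0 => t _; apply: sqr_ge0.
move: hw TT; set w := g (o (e d')) - g (o z); set p := g (o d') - g (o (e d')) => hw TT.
have -> : g (o d') - g (o z) = p + w by rewrite /p /w; ring.
apply: (@le_trans _ _ (a.+1%:R * (T + p ^+ 2))); last by rewrite ler_wpM2l ?ler0n.
move: hw; rewrite -natr1; move: (a%:R) (ler0n R a) => A A0 hw.
have [A1|A1] := eqVneq A 0.
  move: hw; rewrite A1 mul0r add0r mul1r => hw.
  have /eqP w0 : w == 0 by rewrite -sqrf_eq0 eq_le hw sqr_ge0.
  by rewrite w0 addr0; lra.
have {A1}A0 : 0 < A by rewrite lt_neqAle eq_sym A1.
(* (p + w)^2 <= (A + 1) (p^2 + w^2 / A), by expanding (A p - w)^2 >= 0 *)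
rewrite -(ler_pM2l A0).
have h1 := sqr_ge0 (A * p - w).
have h2 : (1 + A) * w ^+ 2 <= (1 + A) * (A * T) by rewrite ler_wpM2l // addr_ge0 // ltW.
rewrite !expr2 in h1 h2 *; nra.
Qed.

(** For g of mean 0, replacing g by its difference with g (z) increases the norm. *)
Lemma poincare g (M : R) : (forall d, (L d - L z)%:~R <= M) -> \sum_d g (o d) = 0 ->
  dot g g <= #|D|%:R * M * (energy g / 2).
Proof.
move=> hM g0; set c := g (o z).
have e2 : energy g = 2 * \sum_(d | L (e d) < L d) (g (o d) - g (o (e d))) ^+ 2.
  rewrite /energy (bigID (fun d => L (e d) < L d)) /=.
  rewrite [X in _ + X](reindex_inj (@perm_inj _ e)) /= mulr_natl mulr2n; congr (_ + _).
  apply: eq_big => d; first by rewrite eK; have := lab_e lab d; lia.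
  by move=> _; rewrite eK -sqrrN opprB.
have hd d : (g (o d) - c) ^+ 2 <= M * (energy g / 2).
  have l0 := lab_min lab d.
  have E : L d = L z + `|L d - L z|%N%:Z by lia.
  have := geodesic_bound g E; set T := \sum_(_ | _) _ => /le_trans; apply.
  have aM : (`|L d - L z|%N)%:R <= M.
    by apply: le_trans (hM d); rewrite le_eqVlt; apply/orP; left; apply/eqP; rewrite -[RHS]/((_ : int)%:~R) pmulrn; congr (_%:~R); lia.
  have T0 : 0 <= T by apply: sumr_ge0 => t _; apply: sqr_ge0.
  apply: (@le_trans _ _ (M * T)); first by rewrite ler_wpM2r.
  rewrite ler_wpM2l //; first by apply: le_trans aM; apply: ler0n.
  rewrite e2 mulrAC mulfV ?mul1r // /T big_mkcond [leRHS]big_mkcond /=.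
  apply: ler_sum => t _; case: ifPn => [/andP[-> _] //|_].
  by case: ifP => _ //; apply: sqr_ge0.
have -> : dot g g = \sum_d ((g (o d) - c) ^+ 2) - #|D|%:R * c ^+ 2.
  have -> : #|D|%:R * c ^+ 2 = \sum_(d : D) c ^+ 2 by rewrite sumr_const mulr_natl.
  rewrite /dot -sumrB; transitivity (\sum_d (g (o d) * g (o d) + (- 2 * c) * g (o d))).
    by rewrite big_split /= -mulr_sumr g0 mulr0 addr0.
  by apply: eq_bigr => d _; ring.
apply: (@le_trans _ _ (\sum_(d : D) M * (energy g / 2))).
  rewrite lerBlDr; apply: ler_wpDr; first by rewrite mulr_ge0 ?sqr_ge0.
  by apply: ler_sum => d _; apply: hd.
by rewrite sumr_const -[_ *+ _]mulr_natl mulrA.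
Qed.

Lemma sum_lazy g : \sum_d ((g (o d) + K g (o d)) / 2) = \sum_d g (o d).
Proof.
have : dot (fun=> 1) (K g) = \sum_d g (o d).
  rewrite dot_mean -[RHS](sum_rev (fun d => g (o d))).
  by apply: eq_bigr => d _; rewrite mul1r.
rewrite /dot (eq_bigr (fun d => K g (o d))); last by move=> d _; rewrite mul1r.
by rewrite -mulr_suml big_split /= => ->; field.
Qed.

Variables (n : nat) (M : R).
Hypothesis hn : (0 < n)%N.
Hypothesis cD : #|D| = (4 * n)%N.
Hypothesis M1 : 1 <= M.
Hypothesis hM : forall d, (L d - L z)%:~R <= M.
Local Notation gam := ((8 * n%:R * M)^-1 : R).

Let n0 : 0 < n%:R :> R. Proof. by rewrite ltr0n. Qed.
Let nM0 : 0 < 8 * n%:R * M. Proof. by rewrite !mulr_gt0 // (lt_le_trans _ M1). Qed.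

Lemma gam_le1 : 0 <= 1 - gam.
Proof.
have n1 : 0 <= n%:R - 1 :> R by rewrite subr_ge0 ler1n.
have M1' : 0 <= M - 1 by rewrite subr_ge0.
rewrite subr_ge0 invf_le1 //; have := mulr_ge0 n1 M1'; nra.
Qed.

Lemma lazy_contracts g : \sum_d g (o d) = 0 ->
  dot (fun x => (g x + K g x) / 2) (fun x => (g x + K g x) / 2) <= (1 - gam) * dot g g.
Proof.
move=> g0; apply: le_trans (lazy_energy g) _.
have := poincare hM g0; rewrite cD natrM => P.
rewrite mulrBl mul1r lerD2l lerN2 mulrC ler_pdivrMr //; move: P; nra.
Qed.

(** The density of the walk after k steps with respect to the stationary measure,
    minus 1: the quantity bounded in [mixed]. *)
Definition deviation (y : {set D}) k (x : {set D}) : R := lazy_pn R m k x y / stationary R m y - 1.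

Let cF : #|faces m| = n.
Proof.
have : (#|faces m| * 4)%N = #|D| by apply: card_porbits_uniform; exact: quad_card4.
by rewrite cD; move: #|_| => f; lia.
Qed.

Lemma stationary_gt0 y : y \in vertices m -> 0 < stationary R m y.
Proof. by move=> yV; rewrite /stationary cF divr_gt0 ?deg_gt0 // mulr_gt0. Qed.

Lemma deviationS y k x : x \in vertices m ->
  deviation y k.+1 x = (deviation y k x + K (deviation y k) x) / 2.
Proof.
move=> xV; rewrite -lazy_pE // /deviation /= mulr_suml.
have one : \sum_(y in vertices m) lazy_p R m x y = 1.
  have := lazy_pE (fun=> 1) xV; rewrite /K sumr_const divff; last first.
    by rewrite -[1 *+ _]/(_%:R) lt0r_neq0 ?deg_gt0.
  rewrite (eq_bigr (fun y => lazy_p R m x y)); last by move=> ? _; rewrite mulr1.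
  by move=> ->; lra.
rewrite -{1}one -sumrB; apply: eq_bigr => y' _; ring.
Qed.

Lemma sum_deviation y k : y \in vertices m -> \sum_d deviation y k (o d) = 0.
Proof.
move=> yV; elim: k => [|k IH].
  rewrite /deviation /= sumrB -mulr_suml sumr_const.
  have -> : \sum_(d : D) (o d == y)%:R = (deg y)%:R :> R.
    rewrite -natr_sum /deg -sum1_card big_mkcond [in RHS]big_mkcond /=; congr (_%:R).
    apply: eq_bigr => d _; have [E|ne] := eqVneq (o d) y.
      by rewrite -{1}E porbit_id.
    by case: ifP => // dy; case/eqP: ne; exact: vertex_orbit.
  rewrite /stationary cF -[1 *+ _]/(#|_|%:R) cardT -cardE cD natrM.
  by have := deg_gt0 yV => h; field; rewrite !lt0r_neq0.
rewrite -[RHS]IH -[RHS]sum_lazy; apply: eq_bigr => d _; apply: deviationS.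
exact: imset_f.
Qed.

(** At time 0 the deviation takes two values, hence satisfies a quadratic equation
    and its norm is obtained from its mean. *)
Lemma deviation_decay y k : y \in vertices m ->
  dot (deviation y k) (deviation y k) <= (1 - gam) ^+ k * (16 * n%:R ^+ 2).
Proof.
move=> yV; have g1 : 0 <= 1 - gam.
  exact: gam_le1.
elim: k => [|k IH].
  rewrite expr0 mul1r /dot.
  have dy := deg_gt0 yV; have sy := stationary_gt0 yV.
  have dy1 : 1 <= (deg y)%:R :> R by rewrite ler1n -(ltr0n R).
  pose q := (stationary R m y)^-1.
  have qE x : deviation y 0 x * deviation y 0 x = (q - 2) * deviation y 0 x + (q - 1).
    by rewrite /deviation /= -/q; case: (x == y) => /=; ring.
  rewrite (eq_bigr _ (fun d _ => qE (o d))) big_split /= -mulr_sumr sum_deviation // mulr0 add0r.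
  rewrite sumr_const -[_ *+ _]mulr_natl cD natrM.
  have : q <= 4 * n%:R.
    by rewrite /q /stationary cF invf_div ler_pdivrMr // ler_peMr ?mulr_ge0.
  move=> hq; have h2 := ler_wpM2l (ltW n0) hq; rewrite expr2; move: (n0) h2. lra.
apply: le_trans (_ : (1 - gam) * dot (deviation y k) (deviation y k) <= _); last first.
  by rewrite [_ ^+ k.+1]exprS -[leRHS]mulrA ler_wpM2l.
apply: le_trans (lazy_contracts (sum_deviation k yV)).
rewrite le_eqVlt; apply/orP; left; apply/eqP; apply: eq_bigr => d _.
by rewrite !deviationS //; apply: imset_f.
Qed.

Lemma mixed_of_radius (eps : R) k : 0 < eps ->
  16 * n%:R ^+ 2 * expR (- (k%:R / (8 * n%:R * M))) <= eps ^+ 2 -> mixed m eps k.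
Proof.
move=> eps0 hk x y xV yV; have sy := stationary_gt0 yV.
have -> : (lazy_pn R m k x y - stationary R m y) / stationary R m y = deviation y k x.
  by rewrite /deviation mulrBl mulfV // lt0r_neq0.
rewrite -(ler_pXn2r (isT : (0 < 2)%N)) ?nnegrE ?normr_ge0 ?(ltW eps0) //.
rewrite real_normK ?num_real //; apply: le_trans hk.
have dec := deviation_decay k yV.
apply: le_trans (_ : dot (deviation y k) (deviation y k) <= _).
  case/imsetP: xV => d _ ->; rewrite /dot (bigD1 d) //= -expr2 lerDl.
  by apply: sumr_ge0 => d' _; rewrite -expr2 sqr_ge0.
apply: le_trans dec _; rewrite mulrC ler_wpM2l ?mulr_ge0 ?sqr_ge0 //.
have -> : - (k%:R / (8 * n%:R * M)) = k%:R * - gam by ring.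
rewrite expRM_natl lerXn2r ?nnegrE ?expR_ge0 //; last exact: expR_ge1Dx.
exact: gam_le1.
Qed.

End Walk.

(** * Radius and mixing of a random quadrangulation *)

Local Open Scope classical_set_scope.
Local Open Scope ring_scope.

(** With s = n^(a/2), the logarithm of n is at most (2 / a) s, against c s^2. *)
Lemma poly_exp_decay (R : realType) (a c : R) : 0 < a -> 0 < c ->
  \forall n \near \oo, n%:R ^+ 3 * expR (- (c * n%:R `^ a)) <= 1 :> R.
Proof.
move=> a0 c0; have a20 : 0 <= a / 2 by rewrite ltW // divr_gt0.
pose B := 6 / (a * c); have B0 : 0 <= B by rewrite ltW // divr_gt0 // mulr_gt0.
near=> n.
have n1 : 1 <= n%:R :> R by near: n; exact: nbhs_infty_ger.
have n0 : 0 < n%:R :> R by lra.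
set s : R := n%:R `^ (a / 2).
have s2 : n%:R `^ a = s ^+ 2.
  by rewrite expr2 -powRD ?gt_eqF ?implybT // -splitr.
have sB : B <= s.
  have -> : B = (B `^ (2 / a)) `^ (a / 2).
    rewrite -powRrM (_ : 2 / a * (a / 2) = 1) ?powRr1 //.
    by field; rewrite gt_eqF.
  apply: ge0_ler_powR => //; rewrite ?nnegrE ?powR_ge0 ?ler0n //.
  by near: n; exact: nbhs_infty_ger.
have sE : s = expR (a / 2 * ln n%:R) by rewrite /s /powR gt_eqF.
have ls : ln n%:R <= 2 / a * s.
  have := expR_ge1Dx (a / 2 * ln n%:R); rewrite -sE => h.
  rewrite mulrAC ler_pdivlMr // mulrC; lra.
have -> : n%:R ^+ 3 = expR (3 * ln n%:R) :> R.
  by rewrite expRM_natl lnK.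
rewrite -expRD -[leRHS]expR0 ler_expR s2.
have s0 : 0 <= s := powR_ge0 _ _.
apply: (@le_trans _ _ (3 * (2 / a * s) - c * s ^+ 2)); first by rewrite lerD2r ler_wpM2l.
have -> : 3 * (2 / a * s) - c * s ^+ 2 = c * s * (B - s).
  by rewrite /B; field; rewrite !gt_eqF.
by rewrite mulr_ge0_le0 ?mulr_ge0 ?(ltW c0) // subr_le0.
Unshelve. all: by end_near. Qed.


(** The exponent exceeds 1/2, for the tail of the labels, and stays below
    1/2 + delta, for the walk. *)
Definition radius (R : realType) (delta : R) (n : nat) : R := n%:R `^ (1 / 2 + delta / 2).

Local Notation fast eps delta n := (fun m : rmap 'I_(4 * n) =>
  (mixing_time m eps <= (n%:R `^ (3 / 2 + delta))%:E)%E).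

Lemma radius_sqrt (R : realType) (delta : R) n : (0 < n)%N -> radius delta n = Num.sqrt n%:R * n%:R `^ (delta / 2).
Proof.
move=> hn; have n0 : n%:R != 0 :> R by rewrite pnatr_eq0 -lt0n.
by rewrite /radius powRD ?n0 ?implybT // mul1r powR12_sqrt.
Qed.

Lemma radius_ge1 (R : realType) (delta : R) n : 0 < delta -> (0 < n)%N -> 1 <= radius delta n.
Proof.
move=> hdelta hn; rewrite -[leLHS](powRr0 n%:R) ler_powR ?ler1n //.
by rewrite addr_ge0 // divr_ge0 // ltW.
Qed.

Lemma mixed_near (R : realType) (eps delta : R) : 0 < eps -> 0 < delta ->
  \forall n \near \oo, forall m : rmap 'I_(4 * n),
  quadrangulation m -> ~ far (radius delta n) m -> fast eps delta n m.
Proof.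
move=> heps hdelta; near=> n; move=> m Q nf.
have n1 : 1 <= n%:R :> R by near: n; exact: nbhs_infty_ger.
have hn : (0 < n)%N by rewrite -(ltr0n R); lra.
have n0 : 0 < n%:R :> R by lra.
have dec : n%:R ^+ 3 * expR (- (1 / 8 * n%:R `^ (delta / 2))) <= 1 :> R.
  by near: n; apply: poly_exp_decay; lra.
have z : 'I_(4 * n) by exists 0%N; lia.
have [L lab] := labelling_exists z Q.
have hM d : (L d - L z)%:~R <= radius delta n.
  by rewrite leNgt; apply/negP => h; apply: nf; exists z, L, d.
set X : R := n%:R `^ (3 / 2 + delta).
have X0 : 0 <= X := powR_ge0 _ _.
(* rounding X down costs at most one step, that is 1 / 8 in the exponent *)
pose k := Num.trunc X; have /andP[k1 k2] := truncn_itv X0.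
apply: ge_ereal_inf; exists (k%:R%:E); last by rewrite lee_fin.
exists k => //; apply: (@mixed_of_radius R _ m L z Q lab n (radius delta n) hn) => //.
- by rewrite card_ord.
- exact: radius_ge1 hdelta hn.
set y : R := n%:R `^ (delta / 2) in dec *.
have XE : X = n%:R * radius delta n * y.
  rewrite /X (_ : 3 / 2 + delta = 1 + (1 / 2 + delta / 2) + delta / 2); last by lra.
  have pD r t : n%:R `^ (r + t) = n%:R `^ r * n%:R `^ t :> R.
    by rewrite powRD // (gt_eqF n0) implybT.
  by rewrite pD [_ `^ (1 + _)]pD powRr1 // ltW.
have M1 := radius_ge1 hdelta hn.
have nM : 0 < n%:R * radius delta n by rewrite mulr_gt0 //; lra.
have kb : y / 8 - 1 / 8 <= k%:R / (8 * n%:R * radius delta n).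
  rewrite ler_pdivlMr; last by rewrite -mulrA mulr_gt0.
  have nM1 : 1 <= n%:R * radius delta n.
    have n1' : 0 <= n%:R - 1 :> R by lra.
    have M1' : 0 <= radius delta n - 1 by lra.
    have := mulr_ge0 n1' M1'; nra.
  have -> : (y / 8 - 1 / 8) * (8 * n%:R * radius delta n) = X - n%:R * radius delta n.
    by rewrite XE; field.
  move: k2; rewrite -natr1 -/k; lra.
apply: (@le_trans _ _ (16 * n%:R ^+ 2 * (expR (1 / 8) * expR (- (1 / 8 * y))))).
  rewrite ler_wpM2l ?mulr_ge0 ?sqr_ge0 // -expRD ler_expR; lra.
have -> : 16 * n%:R ^+ 2 * (expR (1 / 8) * expR (- (1 / 8 * y))) =
    (16 * expR (1 / 8)) * (n%:R ^+ 3 * expR (- (1 / 8 * y))) / n%:R.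
  by field; rewrite gt_eqF.
apply: (@le_trans _ _ (16 * expR (1 / 8) / n%:R)).
  by rewrite ler_wpM2r ?invr_ge0 ?ler0n // -[leRHS]mulr1 ler_wpM2l ?mulr_ge0 ?expR_ge0.
rewrite ler_pdivrMr // [leRHS]mulrC -ler_pdivrMr ?exprn_gt0 //.
by near: n; exact: nbhs_infty_ger.
Unshelve. all: by end_near. Qed.

Lemma far_prob (R : realType) (delta : R) n : 0 < delta -> (0 < n)%N ->
  #|[set C in rooted_quads n | `[< exists2 m, m \in C & far (radius delta n) m >]]%SET|%:R
    <= 32 * expR (3 / 4) * n%:R ^+ 2 * expR (- (1 / 4 * n%:R `^ (delta / 2)))
       * #|rooted_quads n|%:R :> R.
Proof.
move=> hdelta hn; have M1 := radius_ge1 hdelta hn.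
have n0 : 0 < n%:R :> R by rewrite ltr0n.
have := @card_far_classes n hn R (radius delta n) (le_trans ler01 M1).
rewrite -(ler_nat R) => /le_trans; apply.
apply: le_trans (card_wide hn M1) _.
have := card_codes hn; rewrite -(ler_nat R) !natrM => hc.
set y : R := n%:R `^ (delta / 2).
set K := expR _.
have s1 : 1 <= Num.sqrt n%:R :> R by rewrite -[leLHS]sqrtr1 ler_wsqrtr // ler1n.
have KE : K <= expR (3 / 4) * expR (- (1 / 4 * y)).
  rewrite -expRD ler_expR radius_sqrt // -/y.
  have -> : (Num.sqrt n%:R * y - 1) / (4 * Num.sqrt n%:R) = y / 4 - (Num.sqrt n%:R)^-1 / 4.
    by field; rewrite gt_eqF //; lra.
  have : (Num.sqrt n%:R)^-1 <= 1 :> R by rewrite invf_le1; lra.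
  lra.
apply: (@le_trans _ _ (4 * n%:R * (expR (3 / 4) * expR (- (1 / 4 * y))) * (8 * n%:R * #|rooted_quads n|%:R))).
  apply: ler_pM => //; rewrite ?mulr_ge0 ?expR_ge0 ?ler0n //.
  by rewrite ler_wpM2l // mulr_ge0.
by rewrite le_eqVlt; apply/orP; left; apply/eqP; ring.
Qed.

Lemma rooted_quads_gt0 n : (0 < n)%N -> (0 < #|rooted_quads n|)%N.
Proof.
move=> hn; have := card_codes hn; case: posnP => // ->; rewrite muln0.
rewrite leqn0 cards_eq0 => /eqP E.
have k0 : 'I_(2 * n) by exists 0%N; lia.
have [al T] := plane_tree_exists k0.
have : ((true, al), [ffun=> flat]) \in tree_codes n.
  rewrite inE /= T; apply/pffun_onP; split=> //.
  by apply/supportP => c _; rewrite ffunE.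
by rewrite E inE.
Qed.

Lemma fast_prob (R : realType) (eps delta : R) n : 0 < delta -> (0 < n)%N ->
  (forall m : rmap 'I_(4 * n), quadrangulation m -> ~ far (radius delta n) m -> fast eps delta n m) ->
  1 - 32 * expR (3 / 4) * n%:R ^+ 2 * expR (- (1 / 4 * n%:R `^ (delta / 2)))
    <= quad_prob R (fast eps delta n) <= 1.
Proof.
move=> hdelta hn h; have P0 : 0 < #|rooted_quads n|%:R :> R by rewrite ltr0n rooted_quads_gt0.
rewrite /quad_prob; set G := [set C in _ | _]%SET; set P := rooted_quads n in P0 *.
have GP : (#|G| <= #|P|)%N by apply: subset_leq_card; apply/fintype.subsetP => C; rewrite inE => /andP[].
apply/andP; split; last by rewrite ler_pdivrMr // mul1r ler_nat.
rewrite ler_pdivlMr // mulrBl (mul1r #|P|%:R) lerBlDr.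
apply: (@le_trans _ _ (#|G|%:R + #|[set C in P | `[< exists2 m, m \in C & far (radius delta n) m >]]%SET|%:R)).
  rewrite -natrD ler_nat; apply: leq_trans (leq_card_setU _ _).
  apply: subset_leq_card; apply/fintype.subsetP => C CP; rewrite !inE CP /=.
  have [m Q CE] := rooted_quadsP CP.
  have mC : m \in C by rewrite CE inE Q; have [r _] := map_iso_equiv m m m; rewrite r.
  have [f|f] := pselect (far (radius delta n) m); apply/orP; [right|left].
    by apply/asboolP; exists m.
  by apply/asboolP; exists m => //; apply: h.
by rewrite lerD2l far_prob.
Qed.


Theorem theorem1 (R : realType) (eps delta : R)
    (heps : 0 < eps) (hdelta : 0 < delta) :
  (fun n : nat =>
     quad_prob R (fun m : rmap 'I_(4 * n) =>
       (mixing_time m eps <= (n%:R `^ (3 / 2 + delta))%:E)%E))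
    @ \oo --> (1 : R).
Proof.
apply/cvgrPdist_le => e e0; near=> n.
have n1 : 1 <= n%:R :> R by near: n; exact: nbhs_infty_ger.
have hn : (0 < n)%N by rewrite -(ltr0n R); lra.
have n0 : 0 < n%:R :> R by lra.
have h : forall m : rmap 'I_(4 * n), quadrangulation m -> ~ far (radius delta n) m ->
    (mixing_time m eps <= (n%:R `^ (3 / 2 + delta))%:E)%E.
  by near: n; exact: mixed_near.
have /andP[p1 p2] := fast_prob hdelta hn h.
set p := quad_prob _ _ in p1 p2 *.
rewrite ger0_norm ?subr_ge0 //.
apply: le_trans (_ : 32 * expR (3 / 4) / n%:R <= e); last first.
  rewrite ler_pdivrMr // [leRHS]mulrC -ler_pdivrMr //.
  by near: n; exact: nbhs_infty_ger.
have dec : n%:R ^+ 3 * expR (- (1 / 4 * n%:R `^ (delta / 2))) <= 1.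
  by near: n; apply: poly_exp_decay; lra.
move: p1; set E := expR (- _) in dec *.
have -> : 32 * expR (3 / 4) * n%:R ^+ 2 * E = 32 * expR (3 / 4) / n%:R * (n%:R ^+ 3 * E).
  by field; rewrite gt_eqF.
have c0 : 0 <= 32 * expR (3 / 4) / n%:R :> R.
  by rewrite divr_ge0 ?mulr_ge0 ?expR_ge0.
have := ler_wpM2l c0 dec; rewrite mulr1; lra.
Unshelve. all: by end_near. Qed.
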